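(* Let $G$ be a Hausdorff topological group and $\beta\colon \mathrm{M}_c(G)\times \mathrm{M}_c(G)\to \mathrm{M}_c(G)$, $(\mu,\nu)\mapsto\mu*\nu$ be the convolution map on the space of compactly supported complex Radon measures on $G$. (a) If $G$ is hemicompact, then $\beta$ is continuous. (b) If $G$ is spacious, then $\beta$ is not continuous.
   Context: Let $X$ be a Hausdorff topological space with Borel $\sigma$-algebra $\mathcal{B}(X)$. A Borel measure is a positive measure $\mu\colon\mathcal{B}(X)\to[0,\infty]$ with $\mu(K)<\infty$ for each compact $K\subseteq X$; it is a Radon measure if $\mu(A)=\sup\{\mu(K)\colon K\subseteq A \text{ compact}\}$ for all $A\in\mathcal{B}(X)$. The support $\mathrm{supp}(\mu)$ of a Radon measure is the smallest closed subset of $X$ with $\mu(X\setminus\mathrm{supp}(\mu))=0$. A complex measure $\mu\colon\mathcal{B}(X)\to\mathbb{C}$ is a complex Radon measure if its total variation measure $|\mu|$ is a (finite) Radon measure; then $\mathrm{supp}(\mu):=\mathrm{supp}(|\mu|)$ and $\|\mu\|:=|\mu|(X)$. $\mathrm{M}(X)$ is the space of complex Radon measures on $X$; for compact $K\subseteq X$, $\mathrm{M}_K(X)$ is the Banach space $\{\mu\in\mathrm{M}(X)\colon\mathrm{supp}(\mu)\subseteq K\}$ with norm $\|\cdot\|$. $\mathrm{M}_c(X)=\bigcup_K\mathrm{M}_K(X)$ ($K$ ranging over the compact subsets) carries the locally convex direct limit topology. For finite positive Radon measures $\mu,\nu$ on $G$, $\mu\otimes\nu$ is the Radon product measure on $G\times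 G$ (the unique Radon measure with $(\mu\otimes\nu)(A\times B)=\mu(A)\nu(B)$ for $A,B\in\mathcal{B}(G)$), extended bilinearly to complex Radon measures. With $m\colon G\times G\to G$ the group multiplication, $\mu*\nu:=m_*(\mu\otimes\nu)$, i.e. $(\mu*\nu)(A)=(\mu\otimes\nu)(m^{-1}(A))$. A topological space $X$ is hemicompact if $X=\bigcup_{n=1}^\infty K_n$ with compact subsets $K_1\subseteq K_2\subseteq\cdots$ such that each compact subset of $X$ is contained in some $K_n$. A Hausdorff topological group $G$ is spacious if there exist uncountable subsets $A,B\subseteq G$ such that $\{(x,y)\in A\times B\colon xy\in K\}$ is finite for each compact subset $K\subseteq G$. *)

(* Defs.v *)
From HB Require Import structures.
From mathcomp Require Import all_boot all_order all_algebra.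
From mathcomp Require Import complex.
From mathcomp Require Import all_classical all_reals all_analysis.

Set Implicit Arguments.
Unset Strict Implicit.
Unset Printing Implicit Defensive.

Import Order.TTheory GRing.Theory Num.Theory.
Import numFieldNormedType.Exports.

Local Open Scope classical_set_scope.
Local Open Scope ring_scope.

(* Derives the [ptopologicalType] structure of a product of two such spaces. *)
HB.saturate prod.

(* Measurable types are pointed, so spaces are nonempty with an irrelevant
   distinguished point; for a group this excludes nothing. *)
HB.mixin Record isHausdorff (X : Type) & PointedTopological X := {
  hausdorff : hausdorff_space X
}.

#[short(type="hausdorffType")]
HB.structure Definition Hausdorff :=
  {X of PointedTopological X & isHausdorff X}.

HB.mixin Record isTopologicalGroup (G : Type) & Topological G & Group G := {
  mulg_continuous : continuous (fun p : G * G => (p.1 * p.2)%g) ;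
  invg_continuous : continuous (fun x : G => (x^-1)%g)
}.

#[short(type="hausdorffTopGroupType")]
HB.structure Definition HausdorffTopologicalGroup :=
  {G of Hausdorff G & Group G & isTopologicalGroup G}.

Notation borel X := (g_sigma_algebraType (@open X)).

Definition radon (R : realType) (X : ptopologicalType)
    (mu : {measure set (borel X) -> \bar R}) : Prop :=
  (forall K : set X, compact K -> (mu K < +oo)%E) /\
  (forall A : set (borel X), measurable A ->
    mu A = ereal_sup [set mu K | K in [set K : set X | compact K /\ K `<=` A]]).

(* Complex measures are total functions on [set X]. The value 0 off the Borel
   sets makes Leibniz equality of these functions equality of measures. *)
Definition complex_measure (R : realType) (X : ptopologicalType)
    (mu : set (borel X) -> R[i]^o) : Prop :=
  (forall A : set (borel X), ~ measurable A -> mu A = 0) /\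
  (forall F : nat -> set (borel X), (forall k, measurable (F k)) ->
    trivIset setT F ->
    (fun n => \sum_(0 <= k < n) mu (F k)) @ \oo --> mu (\bigcup_k F k)).

(* The value |mu|(A); [complex.Re `|z|] is the modulus of [z] as an element of R.
   The partitions of [A] are countable ([F k] may be empty). For non-Borel [A]
   the supremum is over the empty set. *)
Definition complex_variation (R : realType) (X : ptopologicalType)
    (mu : set (borel X) -> R[i]^o) (A : set (borel X)) : \bar R :=
  ereal_sup [set (\sum_(0 <= k <oo) (complex.Re `|mu (F k)|)%:E)%E | F in
    [set F : nat -> set (borel X) | [/\ forall k, measurable (F k),
                                        trivIset setT F & \bigcup_k F k = A]]].

(* [m] is the measure |mu|; library measures are nonnegative on all sets, hence
   the agreement with |mu| is required on Borel sets only. *)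
Definition complex_radon (R : realType) (X : ptopologicalType)
    (mu : set (borel X) -> R[i]^o) : Prop :=
  complex_measure mu /\
  exists m : {measure set (borel X) -> \bar R},
    [/\ forall A, measurable A -> m A = complex_variation mu A,
        radon m & (m setT < +oo)%E].
Section Modulus.
Context (R : realType).
Implicit Types z w : R[i]^o.
Local Notation md z := (complex.Re `|z : R[i]^o|).

Lemma modE z : `|z| = (md z)%:C%C :> R[i].
Proof. by rewrite normc_def. Qed.

Lemma mod_ge0 z : 0 <= md z.
Proof. by rewrite -lecR -modE normr_ge0. Qed.

Lemma mod0 : md 0 = 0.
Proof. by rewrite normr0. Qed.

Lemma modM z w : md (z * w) = md z * md w.
Proof. by apply: complexI; rewrite rmorphM/= -!modE normrM. Qed.

Lemma le_modD z w : md (z + w) <= md z + md w.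
Proof. by rewrite -lecR rmorphD/= -!modE ler_normD. Qed.

Lemma mod_eq0 z : md z = 0 -> z = 0.
Proof. by move=> z0; apply/normr0_eq0; rewrite modE z0. Qed.

Lemma mod_sum_le n (z : nat -> R[i]^o) :
  md (\sum_(0 <= k < n) z k) <= \sum_(0 <= k < n) md (z k).
Proof.
elim: n => [|n ih]; first by rewrite !big_geq// mod0.
by rewrite !big_nat_recr//= (le_trans (le_modD _ _))// lerD2r.
Qed.

Lemma mod_series_le (z : nat -> R[i]^o) (s : R[i]^o) :
  (fun n => \sum_(0 <= k < n) z k) @ \oo --> s ->
  ((md s)%:E <= \sum_(0 <= k <oo) (md (z k))%:E)%E.
Proof.
move=> zs; set b := (X in (_ <= X)%E).
have b0 n : (0 <= (md (z n))%:E)%E by rewrite lee_fin mod_ge0.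
have bn n : ((\sum_(0 <= k < n) md (z k))%:E <= b)%E.
  by rewrite -sumEFin; exact: nneseries_lim_ge.
apply/lee_addgt0Pr => e e0.
have e0C : 0 < e%:C%C :> R[i] by rewrite (ltcR 0).
move/cvgrPdist_lt : zs => /(_ _ e0C)[n _ /(_ n (leqnn n))] /=.
rewrite modE ltcR => dn.
apply: (@le_trans _ _ ((\sum_(0 <= k < n) md (z k))%:E + e%:E)%E); last exact: leeD.
rewrite -EFinD lee_fin.
rewrite -[s](subrK (\sum_(0 <= k < n) z k)) [leRHS]addrC.
by rewrite (le_trans (le_modD _ _))// lerD// ?mod_sum_le// ltW.
Qed.

End Modulus.

Section TotalVariation.
Context (R : realType) (X : ptopologicalType).
Implicit Types mu nu : set (borel X) -> R[i]^o.
Local Notation md z := (complex.Re `|z : R[i]^o|).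
Local Notation tv := (@complex_variation R X).

Lemma complex_measure0 mu : complex_measure mu -> mu set0 = 0.
Proof.
move=> [_ /(_ (fun=> set0) (fun=> measurable0) (@trivIset_set0 _ _ _))].
move=> /cvgP/cvg_series_cvg_0/(@cvg_lim R[i]^o) h.
by have := h (@norm_hausdorff _ R[i]^o); rewrite lim_cst//; exact: norm_hausdorff.
Qed.

Lemma mod_le_tv mu A : measurable A -> ((md (mu A))%:E <= tv mu A)%E.
Proof.
move=> mA; apply: le_ereal_sup_tmp.
pose F k := if k == 0%N then A else set0.
exists (\sum_(0 <= k <oo) (md (mu (F k)))%:E)%E.
  exists F => //; split.
  - by move=> k; rewrite /F; case: ifP.
  - apply/trivIsetP => -[|i] [|j]//= _ _ _; rewrite /F/=.
    + by rewrite setI0.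
    + by rewrite set0I.
    + by rewrite setI0.
  - apply/seteqP; split=> [x [[|k] _]//|x Ax]; by exists 0%N.
have h := @nneseries_lim_ge R (fun k => (md (mu (F k)))%:E) xpredT 0 1.
apply: (le_trans _ (h _)); first by rewrite big_nat1.
by move=> n _ _; rewrite lee_fin mod_ge0.
Qed.

Lemma tv_ge0 mu A : measurable A -> (0 <= tv mu A)%E.
Proof.
by move=> mA; apply: le_trans (mod_le_tv mu mA); rewrite lee_fin mod_ge0.
Qed.

Lemma tv0 mu : complex_measure mu -> tv mu set0 = 0%E.
Proof.
move=> cmu; apply/eqP; rewrite eq_le tv_ge0// andbT.
apply: ge_ereal_sup => _ [F [mF tF F0] <-].
rewrite eseries0// => k _ _.
have -> : F k = set0 by rewrite -subset0 -F0; exact: bigcup_sup.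
by rewrite complex_measure0// mod0.
Qed.

Lemma tv_superadd mu A B : measurable A -> measurable B -> A `&` B = set0 ->
  (tv mu A + tv mu B <= tv mu (A `|` B))%E.
Proof.
move=> mA mB AB0.
have tvAB := tv_ge0 mu (measurableU _ _ mA mB).
have [->|fAB] := eqVneq (tv mu (A `|` B)) +oo%E; first by rewrite leey.
have key F G : (forall k, measurable (F k)) -> trivIset setT F ->
   \bigcup_k F k = A -> (forall k, measurable (G k)) -> trivIset setT G ->
   \bigcup_k G k = B ->
   (\sum_(0 <= k <oo) (md (mu (F k)))%:E + \sum_(0 <= k <oo) (md (mu (G k)))%:E
      <= tv mu (A `|` B))%E.
  move=> mF tF FA mG tG GB.
  have F0 n : (0 <= (md (mu (F n)))%:E)%E by rewrite lee_fin mod_ge0.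
  have G0 n : (0 <= (md (mu (G n)))%:E)%E by rewrite lee_fin mod_ge0.
  rewrite -nneseriesD//.
  pose H k := if odd k then G k./2 else F k./2.
  have H0 n : (0 <= (md (mu (H n)))%:E)%E by rewrite lee_fin mod_ge0.
  have -> : (\sum_(0 <= k <oo) ((md (mu (F k)))%:E + (md (mu (G k)))%:E) =
             \sum_(0 <= k <oo) ((md (mu (F k)))%:E + (md (mu (G k)))%:E))%E by [].
  apply: (@le_trans _ _ (\sum_(0 <= k <oo) (md (mu (H k)))%:E)%E); last first.
    apply: ereal_sup_ubound; exists H => //; split.
    - by move=> k; rewrite /H; case: ifP.
    - have FG i j x : F i x -> G j x -> False.
        move=> Fx Gx; suff : set0 x by [].
        by rewrite -AB0 -FA -GB; split; [exists i|exists j].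
      apply/trivIsetP => i j _ _ ij; rewrite -subset0 => x [].
      rewrite /H; case: ifPn => oi; case: ifPn => oj.
      + move=> Gi Gj; apply: (negP ij); apply/eqP.
        have := tG i./2 j./2 I I (ex_intro _ x (conj Gi Gj)).
        by rewrite -{2}(odd_double_half i) -{2}(odd_double_half j) oi oj => ->.
      + by move=> Gi Fj; exact: (FG _ _ _ Fj Gi).
      + by move=> Fi Gj; exact: (FG _ _ _ Fi Gj).
      + move=> Fi Fj; apply: (negP ij); apply/eqP.
        have := tF i./2 j./2 I I (ex_intro _ x (conj Fi Fj)).
        rewrite -{2}(odd_double_half i) -{2}(odd_double_half j).
        by rewrite (negbTE oi) (negbTE oj) => ->.
    - rewrite -FA -GB; apply/seteqP; split => x.
        by move=> [k _]; rewrite /H; case: ifP => _ Hx; [right|left]; exists k./2.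
      move=> [|] [k _ Hx]; first by exists k.*2 => //; rewrite /H odd_double doubleK.
      by exists k.*2.+1 => //; rewrite /H/= odd_double/= uphalf_double.
  apply: lime_le; first by apply: is_cvg_nneseries => n _ _; rewrite adde_ge0.
  apply: nearW => n.
  have -> : (\sum_(0 <= k < n) ((md (mu (F k)))%:E + (md (mu (G k)))%:E) =
             \sum_(0 <= k < n.*2) (md (mu (H k)))%:E)%E.
    elim: n => [|n ih]; first by rewrite !big_geq.
    rewrite doubleS !big_nat_recr//= ih /H/= odd_double/= doubleK uphalf_double.
    by rewrite addeA.
  exact: nneseries_lim_ge.
have fin C : measurable C -> (tv mu C <= tv mu (A `|` B))%E -> tv mu C \is a fin_num.
  move=> mC h; rewrite ge0_fin_numE ?tv_ge0// (le_lt_trans h)// ltey//.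
have mon : (tv mu A <= tv mu (A `|` B) /\ tv mu B <= tv mu (A `|` B))%E.
  have e0 C : (forall k : nat, measurable (if k == 0%N then C else set0 : set (borel X))) <-> measurable C.
    split=> [/(_ 0%N)//|mC k]; by case: ifP.
  have t0 (C : set (borel X)) : trivIset setT (fun k : nat => if k == 0%N then C else set0).
    apply/trivIsetP => -[|i] [|j]//= _ _ _; by rewrite ?setI0 ?set0I.
  have u0 (C : set (borel X)) : \bigcup_k (if k == 0%N then C else set0) = C.
    apply/seteqP; split=> [x [[|k] _]//|x Ax]; by exists 0%N.
  split; apply: ge_ereal_sup => _ [F [mF tF FA] <-].
    have := key F _ mF tF FA (proj2 (e0 _) mB) (t0 _) (u0 _).
    apply: le_trans; rewrite leeDl// nneseries_ge0// => n _ _.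
    by rewrite lee_fin mod_ge0.
  have := key _ F (proj2 (e0 _) mA) (t0 _) (u0 _) mF tF FA.
  apply: le_trans; rewrite leeDr// nneseries_ge0// => n _ _.
  by rewrite lee_fin mod_ge0.
have fA := fin _ mA mon.1; have fB := fin _ mB mon.2.
apply/lee_addgt0Pr => e e0.
have e20 : 0 < e / 2 by rewrite divr_gt0.
have [_ [F [mF tF FA] <-] hF] := ub_ereal_sup_adherent e20 fA.
have [_ [G [mG tG GB] <-] hG] := ub_ereal_sup_adherent e20 fB.
rewrite -/(tv mu A) in hF; rewrite -/(tv mu B) in hG.
apply: (@le_trans _ _ ((\sum_(0 <= k <oo) (md (mu (F k)))%:E + (e/2)%:E) + (\sum_(0 <= k <oo) (md (mu (G k)))%:E + (e/2)%:E))%E).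
  by rewrite leeD// -leeBlDr// ltW.
by rewrite addeACA -EFinD -splitr leeD2r// key.
Qed.

Lemma tv_measure_ex mu : complex_measure mu ->
  exists m : {measure set (borel X) -> \bar R},
    forall A, measurable A -> m A = tv mu A.
Proof.
move=> cmu.
pose f (A : set (borel X)) : \bar R := if `[< measurable A >] then tv mu A else 0%E.
have fE A : measurable A -> f A = tv mu A by move=> mA; rewrite /f asboolT.
have f0 : f set0 = 0%E by rewrite fE// tv0.
have f_ge0 A : (0 <= f A)%E.
  by rewrite /f; case: ifPn => // /asboolP; exact: tv_ge0.
have f_sigma : semi_sigma_additive f.
  move=> F mF tF mUF.
  suff -> : f (\bigcup_n F n) = (\sum_(0 <= k <oo) f (F k))%E.
    exact: is_cvg_nneseries.
  rewrite fE//; apply/eqP; rewrite eq_le; apply/andP; split.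
    apply: ge_ereal_sup => _ [G [mG tG GF] <-].
    apply: (@le_trans _ _ (\sum_(0 <= k <oo) \sum_(0 <= j <oo) (md (mu (G k `&` F j)))%:E)%E).
      apply: lee_nneseries => k _; first by rewrite lee_fin mod_ge0.
      apply: mod_series_le.
      have -> : mu (G k) = mu (\bigcup_j (G k `&` F j)).
        by rewrite -setI_bigcupr -GF setIidl//; exact: bigcup_sup.
      apply: cmu.2 => [j|]; first exact: measurableI.
      exact: trivIset_setIl.
    rewrite nneseries_interchange; last by move=> i j; rewrite lee_fin mod_ge0.
    apply: lee_nneseries => j _.
      by rewrite nneseries_ge0// => n _ _; rewrite lee_fin mod_ge0.
    rewrite fE//; apply: ereal_sup_ubound; exists (fun k => G k `&` F j) => //.
    split=> [k||]; first exact: measurableI.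
    - exact: trivIset_setIr.
    - rewrite -setI_bigcupl GF setIidr//; exact: bigcup_sup.
  apply: lime_le; first exact: is_cvg_nneseries.
  apply: nearW => n.
  have -> : (\sum_(0 <= k < n) f (F k) = \sum_(0 <= k < n) tv mu (F k))%E.
    by apply: eq_bigr => k _; rewrite fE.
  have mU k : measurable (\big[setU/set0]_(i < k) F i : set (borel X)).
    by apply: bigsetU_measurable.
  have h : (\sum_(0 <= k < n) tv mu (F k) <= tv mu (\big[setU/set0]_(i < n) F i))%E.
    elim: n => [|n ih]; first by rewrite big_geq// big_ord0 tv0.
    rewrite big_nat_recr//= big_ord_recr/=.
    have t : \big[setU/set0]_(i < n) F i `&` F n = set0.
      apply: (@trivIset_bigsetUI _ xpredT) => //.
      by move=> i j _ _; exact: tF.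
    by apply: le_trans (tv_superadd _ _ _ t) => //; rewrite leeD2r.
  apply: (le_trans h).
  have -> : \bigcup_n F n = (\big[setU/set0]_(i < n) F i) `|` (\bigcup_n F n `\` \big[setU/set0]_(i < n) F i).
    rewrite setDUK// -bigcup_mkord; by move=> x [k _ Fx]; exists k.
  apply: le_trans (tv_superadd _ _ _ _) => //.
  - by rewrite leeDl// tv_ge0//; exact: measurableD.
  - exact: measurableD.
  - by rewrite setDIK.
pose m : {measure set (borel X) -> \bar R} :=
  HB.pack f (isMeasure.Build _ _ _ f f0 f_ge0 f_sigma).
by exists m.
Qed.

End TotalVariation.

(* The intersection of all closed |mu|-conull sets; for complex Radon measures it
   is itself conull, by [tv_supp] below, and thus the smallest one. *)
Definition supp (R : realType) (X : ptopologicalType)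
    (mu : set (borel X) -> R[i]^o) : set X :=
  \bigcap_(C in [set C : set X | closed C /\ complex_variation mu (~` C) = 0%E]) C.

Section ComplexRadonClosed.
Context (R : realType) (X : hausdorffType).
Implicit Types mu nu : set (borel X) -> R[i]^o.
Local Notation md z := (complex.Re `|z : R[i]^o|).
Local Notation tv := (@complex_variation R X).

Lemma open_borel (U : set X) : open U -> measurable (U : set (borel X)).
Proof. by move=> oU; exact: sub_sigma_algebra. Qed.

Lemma closed_borel (C : set X) : closed C -> measurable (C : set (borel X)).
Proof.
move=> cC; rewrite -[C]setCK; apply: measurableC; apply: open_borel.
exact: closed_openC.
Qed.

Lemma compact_borel (K : set X) : compact K -> measurable (K : set (borel X)).
Proof.
move=> cK; apply: closed_borel.
apply: compact_closed cK.
exact: hausdorff.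
Qed.

Lemma tv_lin (a : R[i]) mu nu A : measurable A ->
  (tv (a *: mu + nu)%R A <= (md a)%:E * tv mu A + tv nu A)%E.
Proof.
move=> mA; apply: ge_ereal_sup => _ [F [mF tF FA] <-].
apply: (@le_trans _ _ ((md a)%:E * \sum_(0 <= k <oo) (md (mu (F k)))%:E +
                       \sum_(0 <= k <oo) (md (nu (F k)))%:E)%E); last first.
  apply: leeD; last by apply: ereal_sup_ubound; exists F.
  apply: lee_wpmul2l; first by rewrite lee_fin mod_ge0.
  by apply: ereal_sup_ubound; exists F.
rewrite -nneseriesZl; last by move=> k _; rewrite lee_fin mod_ge0.
rewrite -nneseriesD; last 2 first.
- by move=> k _ _; rewrite -EFinM lee_fin mulr_ge0 ?mod_ge0.
- by move=> k _ _; rewrite lee_fin mod_ge0.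
apply: lee_nneseries => k _; first by rewrite lee_fin mod_ge0.
by rewrite -EFinM -EFinD lee_fin -modM le_modD.
Qed.

Lemma complex_measure_lin (a : R[i]) mu nu :
  complex_measure mu -> complex_measure nu -> complex_measure (a *: mu + nu).
Proof.
move=> [mu0 smu] [nu0 snu]; split=> [A nmA|F mF tF].
  by rewrite /GRing.add/= /GRing.scale/= mu0// nu0// scaler0 addr0.
rewrite (_ : (fun n => _) = (fun n => a *: (\sum_(0 <= k < n) mu (F k) : R[i]^o) +
                                       \sum_(0 <= k < n) nu (F k))).
  by apply: cvgD; [apply: cvgZr; exact: smu|exact: snu].
apply/funext => n; rewrite scaler_sumr -big_split/=.
by apply: eq_bigr.
Qed.

Lemma complex_radon_null mu (A : set (borel X)) (e : R) : complex_radon mu -> measurable A -> 0 < e ->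
  exists K : set (borel X), [/\ compact (K : set X), K `<=` A & (tv mu (A `\` K) < e%:E)%E].
Proof.
move=> [cmu [m [mE [_ rm] fm]]] mA e0.
have fA : m A \is a fin_num.
  by rewrite ge0_fin_numE// (le_lt_trans _ fm)// le_measure ?inE.
have [_ [K [cK KA] <-]] : exists2 x,
    [set m K | K in [set K : set X | compact K /\ K `<=` A]] x & (m A - e%:E < x)%E.
  by rewrite rm//; apply: ub_ereal_sup_adherent => //; rewrite -rm.
move=> h; exists K; split=> //.
have mK := compact_borel cK.
rewrite -mE; last exact: measurableD.
rewrite measureD//; last by rewrite ltey_eq fA.
rewrite setIidr// lteBlDr; last first.
  by rewrite ge0_fin_numE// (le_lt_trans _ fm)// le_measure ?inE.
by rewrite addeC -lteBlDr.
Qed.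

Lemma tv_mono mu A B : complex_radon mu -> measurable A -> measurable B ->
  A `<=` B -> (tv mu A <= tv mu B)%E.
Proof.
by move=> [_ [m [mE _ _]]] mA mB AB; rewrite -!mE// le_measure ?inE.
Qed.

Lemma tv_fin mu A : complex_radon mu -> measurable A -> tv mu A \is a fin_num.
Proof.
move=> rmu mA; rewrite ge0_fin_numE ?tv_ge0//.
apply: (le_lt_trans (tv_mono rmu mA measurableT (@subsetT _ _))).
by case: rmu => _ [m [<-]].
Qed.

Lemma complex_radon_lin (a : R[i]) mu nu :
  complex_radon mu -> complex_radon nu -> complex_radon (a *: mu + nu).
Proof.
move=> rmu rnu.
have cl := complex_measure_lin a rmu.1 rnu.1.
split=> //; have [m mE] := tv_measure_ex cl.
have fin A : measurable A -> (m A < +oo)%E.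
  move=> mA; rewrite mE// (le_lt_trans (tv_lin _ _ _ mA))//.
  rewrite lte_add_pinfty// ltey_eq ?fin_numM ?tv_fin//.
exists m; split => //; last exact: fin.
split=> [K cK|A mA]; first by apply: fin; exact: compact_borel.
apply/eqP; rewrite eq_le; apply/andP; split; last first.
  apply: ge_ereal_sup => _ [K [cK KA] <-].
  by rewrite le_measure ?inE//; exact: compact_borel.
apply/lee_addgt0Pr => e e0.
have c0 : 0 < md a + 1 by rewrite ltr_wpDl ?mod_ge0.
have e1 : 0 < e / (md a + 1) by rewrite divr_gt0.
have [K [cK KA hK]] := complex_radon_null rmu mA (divr_gt0 e1 (ltr0Sn _ 1)).
have [L [cL LA hL]] := complex_radon_null rnu mA (divr_gt0 e0 (ltr0Sn _ 1)).
have mK := compact_borel cK.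
have mL := compact_borel cL.
have mKL := measurableU _ _ mK mL.
have KLA : K `|` L `<=` A by rewrite subUset.
apply: (@le_trans _ _ (m (K `|` L) + m (A `\` (K `|` L)))%E).
  rewrite -measureU//; first by rewrite setDUK.
  - exact: measurableD.
  - by rewrite setDIK.
apply: leeD; first by apply: ereal_sup_ubound; exists (K `|` L) => //; split=> //; exact: compactU.
have mD : measurable (A `\` (K `|` L)) by exact: measurableD.
rewrite mE//; apply: (le_trans (tv_lin _ _ _ mD)).
have -> : e = e / 2 + e / 2 by rewrite -splitr.
rewrite EFinD leeD//; last first.
  apply: le_trans (ltW hL); apply: tv_mono => //; first exact: measurableD.
  by apply: setDS => x; right.
apply: (@le_trans _ _ ((md a)%:E * (e / (md a + 1) / 2)%:E)%E).
  apply: lee_wpmul2l; first by rewrite lee_fin mod_ge0.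
  apply: le_trans (ltW hK); apply: tv_mono => //; first exact: measurableD.
  by apply: setDS => x; left.
rewrite -EFinM lee_fin mulrA ler_pM2r// mulrCA ger_pMr//.
by rewrite ler_pdivrMr// mul1r lerDl.
Qed.

Lemma tv_cst0 A : (tv (0%R : set (borel X) -> R[i]^o) A <= 0)%E.
Proof.
apply: ge_ereal_sup => _ [F _ <-].
by rewrite eseries0// => k _ _; rewrite mod0.
Qed.

Lemma complex_radon0 : complex_radon (0 : set (borel X) -> R[i]^o).
Proof.
have c0 : complex_measure (0 : set (borel X) -> R[i]^o).
  split=> // F _ _; rewrite (_ : (fun n => _) = fun=> 0); first exact: cvg_cst.
  by apply/funext => n; rewrite big1.
split=> //; have [m mE] := tv_measure_ex c0.
have m0 A : measurable A -> m A = 0%E.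
  by move=> mA; apply/eqP; rewrite eq_le measure_ge0 andbT mE// tv_cst0.
exists m; split => //; last by rewrite m0.
split=> [K cK|A mA]; first by rewrite m0//; exact: compact_borel.
rewrite m0//; apply/eqP; rewrite eq_le; apply/andP; split.
  apply: le_ereal_sup_tmp; exists (m set0); rewrite ?measure0//.
  exists set0 => //; rewrite ?measure0//; split=> //; exact: compact0.
by apply: ge_ereal_sup => _ [K [cK _] <-]; rewrite m0//; exact: compact_borel.
Qed.

Lemma tvZ (a : R[i]) mu A : measurable A ->
  tv (a *: mu)%R A = ((md a)%:E * tv mu A)%E.
Proof.
have le1 (b : R[i]) la : measurable A -> (tv (b *: la)%R A <= (md b)%:E * tv la A)%E.
  move=> mA; rewrite -[b *: la]addr0 (le_trans (tv_lin _ _ _ mA))//.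
  by rewrite -[leRHS]adde0 leeD2l// tv_cst0.
move=> mA; have [->|a0] := eqVneq a 0.
  rewrite mod0 mul0e scale0r; apply/eqP; rewrite eq_le tv_cst0/= tv_ge0//.
apply/eqP; rewrite eq_le le1//=.
have := le1 a^-1 (a *: mu) mA; rewrite scalerA mulVf// scale1r.
have ma : 0 < md a.
  by rewrite lt_neqAle mod_ge0 andbT eq_sym; apply: contra_neq a0; exact: mod_eq0.
move=> h; apply: (le_trans (lee_wpmul2l _ h)); first by rewrite lee_fin mod_ge0.
rewrite muleA -EFinM -modM mulfV//.
by rewrite normr1/= mul1e.
Qed.

Lemma closed_supp mu : closed (supp mu).
Proof. by apply: closed_bigI => C -[]. Qed.

Lemma tv_supp mu : complex_radon mu -> tv mu (~` supp mu) = 0%E.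
Proof.
move=> /[dup] rmu [_ [m [mE [_ rm] _]]].
have msC : measurable (~` supp mu : set (borel X)).
  by apply: measurableC; apply: closed_borel; exact: closed_supp.
rewrite -mE// rm//; apply/eqP; rewrite eq_le; apply/andP; split; last first.
  apply: le_ereal_sup_tmp; exists (m set0); rewrite ?measure0//.
  by exists set0 => //; rewrite ?measure0//; split=> //; exact: compact0.
apply: ge_ereal_sup => _ [K [cK Ks] <-].
have := cK; rewrite compact_cover => /(_ (set X : choiceType)
  [set C : set X | closed C /\ tv mu (~` C) = 0%E] (fun C => ~` C)).
case=> [C [cC _]|x Kx|D' D'D KD]; first exact: closed_openC.
  have /existsNP[C /not_implyP[? ?]] := Ks x Kx; by exists C.
have mD (s : seq (set (borel X))) :
    (forall C, C \in s -> closed (C : set X) /\ tv mu (~` C) = 0%E) ->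
    measurable (\big[setU/set0]_(C <- s) ~` C) /\
    m (\big[setU/set0]_(C <- s) ~` C) = 0%E.
  elim: s => [|C s ih] sP; first by rewrite big_nil measure0; split.
  have [|mU mU0] := ih; first by move=> B Bs; apply: sP; rewrite inE Bs orbT.
  have [cC C0] := sP C (mem_head _ _).
  have mC : measurable (~` C) by apply: measurableC; exact: closed_borel.
  rewrite big_cons; split; first exact: measurableU.
  apply/eqP; rewrite eq_le measure_ge0 andbT.
  have m0 : m (~` C) = 0%E by rewrite mE.
  apply: (le_trans (measureU2 _ mC mU)).
  by rewrite [X in (X + _)%E](_ : _ = 0%E)// [X in (_ + X)%E](_ : _ = 0%E)// adde0.
have [] := mD (finmap.enum_fset D').
  by move=> C CD; have := D'D C CD; rewrite inE.
move=> mU <-; rewrite le_measure ?inE//; first exact: compact_borel.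
by move=> x /KD[C CD xC]; rewrite -bigcup_seq; exists C.
Qed.

Lemma supp_lin (a : R[i]) mu nu : complex_radon mu -> complex_radon nu ->
  supp (a *: mu + nu) `<=` supp mu `|` supp nu.
Proof.
move=> rmu rnu; apply: bigcap_inf; split.
  by apply: closedU; exact: closed_supp.
have mC : measurable (~` (supp mu `|` supp nu) : set (borel X)).
  by apply: measurableC; apply: closed_borel; apply: closedU; exact: closed_supp.
apply/eqP; rewrite eq_le tv_ge0// andbT (le_trans (tv_lin _ _ _ mC))//.
rewrite (_ : tv mu _ = 0%E); last first.
  apply/eqP; rewrite eq_le tv_ge0// andbT -(tv_supp rmu) tv_mono//.
    by apply: measurableC; apply: closed_borel; exact: closed_supp.
  by apply: subsetC => x; left.
rewrite (_ : tv nu _ = 0%E); last first.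
  apply/eqP; rewrite eq_le tv_ge0// andbT -(tv_supp rnu) tv_mono//.
    by apply: measurableC; apply: closed_borel; exact: closed_supp.
  by apply: subsetC => x; right.
by rewrite mule0 adde0.
Qed.

Lemma supp_cst0 : supp (0 : set (borel X) -> R[i]^o) = set0.
Proof.
rewrite -subset0; apply: bigcap_inf; split; first exact: closed0.
by apply/eqP; rewrite eq_le tv_cst0 tv_ge0//; exact: measurableC.
Qed.

End ComplexRadonClosed.

Definition complex_radon_pred (R : realType) (X : hausdorffType) :
  {pred set (borel X) -> R[i]^o} := fun mu => `[< complex_radon mu >].

Fact complex_radon_submod_closed (R : realType) (X : hausdorffType) :
  submod_closed (@complex_radon_pred R X).
Proof.
split=> [|a mu nu /asboolP rmu /asboolP rnu]; apply/asboolP.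
  exact: complex_radon0.
exact: complex_radon_lin.
Qed.

HB.instance Definition _ (R : realType) (X : hausdorffType) :=
  GRing.isSubmodClosed.Build R[i] (set (borel X) -> R[i]^o)
    (@complex_radon_pred R X) (@complex_radon_submod_closed R X).

Record radonM (R : realType) (X : hausdorffType) := RadonM {
  radonM_fun :> set (borel X) -> R[i]^o ;
  radonM_subproof : radonM_fun \in @complex_radon_pred R X
}.

HB.instance Definition _ (R : realType) (X : hausdorffType) :=
  [isSub for @radonM_fun R X].
HB.instance Definition _ (R : realType) (X : hausdorffType) :=
  [Choice of radonM R X by <:].
HB.instance Definition _ (R : realType) (X : hausdorffType) :=
  [SubChoice_isSubLmodule of radonM R X by <:].

Lemma radonMP (R : realType) (X : hausdorffType) (mu : radonM R X) :
  complex_radon mu.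
Proof. exact/asboolP/radonM_subproof. Qed.

Definition supported_in (R : realType) (X : hausdorffType) (K : set X) :
  {pred radonM R X} := fun mu => `[< supp mu `<=` K >].

Fact supported_in_submod_closed (R : realType) (X : hausdorffType) (K : set X) :
  submod_closed (@supported_in R X K).
Proof.
split=> [|a mu nu /asboolP smu /asboolP snu]; apply/asboolP.
  by rewrite [supp _]supp_cst0.
have := supp_lin (a := a) (radonMP mu) (radonMP nu).
by move=> /subset_trans; apply; rewrite subUset.
Qed.

HB.instance Definition _ (R : realType) (X : hausdorffType) (K : set X) :=
  GRing.isSubmodClosed.Build R[i] (radonM R X)
    (@supported_in R X K) (@supported_in_submod_closed R X K).

(* The space M_K(X), with the norm |mu|(X). The order of R[i], in which the library
   norms take their values, restricts to that of R on real numbers. *)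
Record radonM_in (R : realType) (X : hausdorffType) (K : set X) := RadonMIn {
  radonM_in_val :> radonM R X ;
  radonM_in_subproof : radonM_in_val \in @supported_in R X K
}.

HB.instance Definition _ (R : realType) (X : hausdorffType) (K : set X) :=
  [isSub for @radonM_in_val R X K].
HB.instance Definition _ (R : realType) (X : hausdorffType) (K : set X) :=
  [Choice of radonM_in R K by <:].
HB.instance Definition _ (R : realType) (X : hausdorffType) (K : set X) :=
  [SubChoice_isSubLmodule of radonM_in R K by <:].

Definition radonM_norm (R : realType) (X : hausdorffType) (mu : radonM R X) : R :=
  fine (complex_variation mu setT).

Section RadonMNorm.
Context (R : realType) (X : hausdorffType) (K : set X).
Implicit Types mu nu : radonM_in R K.

Let norm mu : R[i] := (radonM_norm mu)%:C%C.

Fact ler_radonM_normD mu nu : norm (mu + nu) <= norm mu + norm nu.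
Proof.
have [rmu rnu rD] := And3 (radonMP mu) (radonMP nu) (radonMP (mu + nu : radonM_in R K)).
rewrite /norm -rmorphD/= lecR /radonM_norm -fineD ?tv_fin//.
apply: fine_le; rewrite ?fin_numD ?tv_fin//.
have := tv_lin 1 (mu : set (borel X) -> R[i]^o) (nu : set (borel X) -> R[i]^o) measurableT.
by rewrite scale1r normr1/= mul1e.
Qed.

Fact radonM_normZ (a : R[i]) mu : norm (a *: mu) = `|a| * norm mu.
Proof.
rewrite /norm /radonM_norm.
have := tvZ a (mu : set (borel X) -> R[i]^o) measurableT.
rewrite [in RHS]normc_def -rmorphM/= => h; congr (_%:C%C).
rewrite [complex_variation _ _]h fineM//; first by case: a {h}.
by rewrite tv_fin//; exact: radonMP.
Qed.

Fact radonM_norm_eq0 mu : norm mu = 0 -> mu = 0.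
Proof.
move=> /(congr1 (@complex.Re R))/= n0; have rmu := radonMP mu.
apply: val_inj; apply: val_inj; apply/funext => A /=.
have [mA|nmA] := pselect (measurable (A : set (borel X))); last first.
  by have [[-> //]] := rmu.
apply: mod_eq0; apply/eqP; rewrite eq_le mod_ge0 andbT -lee_fin.
apply: (le_trans (mod_le_tv mu mA)).
apply: (le_trans (tv_mono rmu mA measurableT (@subsetT _ _))).
by rewrite -[leLHS]fineK ?tv_fin// lee_fin -/(radonM_norm mu) n0.
Qed.

HB.instance Definition _ := Lmodule_isNormed.Build R[i] (radonM_in R K)
  ler_radonM_normD radonM_normZ radonM_norm_eq0.

End RadonMNorm.

Definition compactly_supported (R : realType) (X : hausdorffType) :
    {pred radonM R X} :=
  fun mu => `[< exists2 K : set X, compact K & mu \in supported_in K >].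

Fact compactly_supported_submod_closed (R : realType) (X : hausdorffType) :
  submod_closed (@compactly_supported R X).
Proof.
split=> [|a mu nu /asboolP[K cK smu] /asboolP[L cL snu]]; apply/asboolP.
  by exists set0; [exact: compact0|exact: rpred0].
exists (K `|` L); first exact: compactU.
apply: rpredD; first apply: rpredZ.
- by move/asboolP : smu => smu; apply/asboolP => x /smu; left.
- by move/asboolP : snu => snu; apply/asboolP => x /snu; right.
Qed.

HB.instance Definition _ (R : realType) (X : hausdorffType) :=
  GRing.isSubmodClosed.Build R[i] (radonM R X)
    (@compactly_supported R X) (@compactly_supported_submod_closed R X).

Record radonMc (R : realType) (X : hausdorffType) := RadonMc {
  radonMc_val :> radonM R X ;
  radonMc_subproof : radonMc_val \in @compactly_supported R X
}.

HB.instance Definition _ (R : realType) (X : hausdorffType) :=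
  [isSub for @radonMc_val R X].
HB.instance Definition _ (R : realType) (X : hausdorffType) :=
  [Choice of radonMc R X by <:].
HB.instance Definition _ (R : realType) (X : hausdorffType) :=
  [SubChoice_isSubLmodule of radonMc R X by <:].

Fact radonMc_incl_subproof (R : realType) (X : hausdorffType) (K : set X)
    (cK : compact K) (mu : radonM_in R K) :
  (mu : radonM R X) \in @compactly_supported R X.
Proof. by apply/asboolP; exists K => //; exact: radonM_in_subproof. Qed.

Definition radonMc_incl (R : realType) (X : hausdorffType) (K : set X)
    (cK : compact K) (mu : radonM_in R K) : radonMc R X :=
  RadonMc (radonMc_incl_subproof cK mu).

(* [T] is a (not necessarily Hausdorff) locally convex vector topology on M_c(X)
   for which all inclusions of the Banach spaces M_K(X), K compact, are
   continuous. *)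
Definition lc_compatible (R : realType) (X : hausdorffType)
    (T : Topological (radonMc R X)) : Prop :=
  let E : topologicalType := Topological.Pack T in
  [/\ continuous (fun p : E * E => (p.1 : radonMc R X) + p.2 : E),
      continuous (fun p : R[i]^o * E => p.1 *: (p.2 : radonMc R X) : E),
      exists2 B : set (set E),
        (forall b : set (radonMc R X), B b -> convex_set b) & basis B &
      forall (K : set X) (cK : compact K),
        continuous (radonMc_incl cK : radonM_in R K -> E)].

(* The locally convex direct limit topology is the finest topology satisfying
   [lc_compatible]: it is defined as the supremum of all of these, and satisfies
   [lc_compatible] itself by [lc_compatible_radonMc]. ([sup_topology] does not
   apply because of the universe level of its index type.) *)
Definition lc_open (R : realType) (X : hausdorffType) : set (set (radonMc R X)) :=
  [set U : set (radonMc R X) | exists2 T : Topological (radonMc R X),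
    lc_compatible T & @open (Topological.Pack T) U].

HB.instance Definition _ (R : realType) (X : hausdorffType) :=
  isSubBaseTopological.Build (radonMc R X) (@lc_open R X) id.


Section DirectLimitTopology.
Context (R : realType) (X : hausdorffType).
Local Notation Mc := (radonMc R X).

Lemma lc_open_open (U : set Mc) : lc_open U -> open U.
Proof.
move=> lU; exists [set U]; last by rewrite bigcup_set1.
by move=> _ ->; exact: (@finI_from1 _ _ _ id).
Qed.

Lemma lc_nbhs (T : Topological Mc) (x : Mc) (A : set Mc) :
  lc_compatible T -> @nbhs _ (Topological.Pack T) x A -> nbhs x A.
Proof.
move=> lT; rewrite nbhsE => -[U [oU Ux] UA].
rewrite nbhsE; exists U => //; split => //; apply: lc_open_open.
by exists T.
Qed.

Lemma lc_cvg (F : set_system Mc) (x : Mc) : Filter F ->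
  (forall T : Topological Mc, lc_compatible T ->
    F --> (x : (Topological.Pack T : topologicalType))) -> F --> x.
Proof.
move=> FF Fx A; rewrite nbhsE => -[_ [[B sB <-] [C BC Cx]] UA].
rewrite nbhs_filterE; apply: filterS UA _; apply: (@filterS _ _ _ C).
  by move=> ? ?; exists C.
have /sB[D sD IDC] := BC; rewrite -IDC; apply: filter_bigI => E DE.
have := sD _ DE; rewrite inE => -[T lT oE].
apply: (Fx T lT); apply: open_nbhs_nbhs; split=> //.
by move: Cx; rewrite -IDC; apply.
Qed.

Lemma lc_compatible_radonMc : lc_compatible (Topological.class Mc).
Proof.
split=> [[x y]|[a x]||K cK mu].
- apply: lc_cvg => T lT A nA.
  have [+ _ _ _] := lT; move=> /(_ (x, y) A nA)[[/= U V] [nU nV] UV].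
  by exists (U, V) => //; split; exact: (lc_nbhs lT).
- apply: lc_cvg => T lT A nA.
  have [_ + _ _] := lT; move=> /(_ (a, x) A nA)[[/= U V] [nU nV] UV].
  by exists (U, V) => //; split=> //; exact: (lc_nbhs lT).
- exists [set U : set Mc | open U /\ convex_set U] => [b []//|].
  split=> [b []//|x]; apply: lc_cvg => [|T lT A nA].
    apply: filter_from_filter.
      by exists setT; split=> //; split; [exact: openT|move=> ? ? ? _ _; rewrite inE].
    move=> U V [[oU cU] Ux] [[oV cV] Vx]; exists (U `&` V) => //.
    split=> //; split; first exact: openI.
    move=> y z l; rewrite !inE => -[Uy Vy] [Uz Vz]; split; apply/set_mem.
      by apply: cU; exact: mem_set.
    by apply: cV; exact: mem_set.
  have [_ _ [B cB [Bo Bx]] _] := lT.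
  have [b [Bb bx] bA] := Bx x A nA; exists b => //; split=> //; split; last exact: cB.
  by apply: lc_open_open; exists T => //; exact: Bo.
- apply: lc_cvg => [|T lT A nA]; first by apply: fmap_filter; apply: nbhs_filter.
  by have [_ _ _ iK] := lT; exact: (iK K cK mu).
Qed.

Let radonMc_add : continuous (fun p : Mc * Mc => p.1 + p.2).
Proof. by have [] := lc_compatible_radonMc. Qed.

Let radonMc_scale : continuous (fun p : R[i]^o * Mc => p.1 *: p.2).
Proof. by have [] := lc_compatible_radonMc. Qed.

Let radonMc_convex : exists2 B : set_system Mc,
  (forall b, b \in B -> convex_set b) & basis B.
Proof.
have [_ _ [B cB bB] _] := lc_compatible_radonMc.
by exists B => // b /set_mem; exact: cB.
Qed.

HB.instance Definition _ := PreTopologicalLmod_isTvs.Build R[i] Mc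
  radonMc_add radonMc_scale radonMc_convex.

End DirectLimitTopology.


(* For j = 0, 1, 2, 3: the positive part of Re mu, the positive part of Im mu, the
   negative part of Re mu and the negative part of Im mu, where the positive part
   of a real measure s is A |-> sup {s(B) : B Borel, B <= A}. Thus mu is the sum
   of 'i ^+ j times its j-th part. *)
Definition jordan_part (R : realType) (X : ptopologicalType) (j : nat)
    (mu : set (borel X) -> R[i]^o) (A : set (borel X)) : \bar R :=
  ereal_sup [set (complex.Re ((- 'i%C) ^+ j * mu B : R[i]))%:E | B in
    [set B : set (borel X) | measurable B /\ B `<=` A]].

Definition is_radon_product (R : realType) (X Y : ptopologicalType)
    (mu : set (borel X) -> \bar R) (nu : set (borel Y) -> \bar R)
    (rho : {measure set (borel (X * Y)%type) -> \bar R}) : Prop :=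
  radon rho /\
  forall (A : set (borel X)) (B : set (borel Y)), measurable A -> measurable B ->
    rho (A `*` B) = (mu A * nu B)%E.

(* The default [mzero] is never taken for finite Radon measures on Hausdorff
   spaces: then the Radon product exists, and it is unique. *)
Definition radon_product (R : realType) (X Y : ptopologicalType)
    (mu : set (borel X) -> \bar R) (nu : set (borel Y) -> \bar R) :
    {measure set (borel (X * Y)%type) -> \bar R} :=
  if pselect (exists rho, is_radon_product mu nu rho) is left h
  then projT1 (cid h) else mzero.

(* The bilinear extension of [radon_product], computed on the Jordan parts. *)
Definition complex_radon_product (R : realType) (X Y : ptopologicalType)
    (mu : set (borel X) -> R[i]^o) (nu : set (borel Y) -> R[i]^o)
    (C : set (borel (X * Y)%type)) : R[i] :=
  \sum_(j < 4) \sum_(k < 4) ('i%C) ^+ (j + k) *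
    (fine (radon_product (jordan_part j mu) (jordan_part k nu) C))%:C%C.

Definition convolution_fun (R : realType) (G : hausdorffTopGroupType)
    (mu nu : set (borel G) -> R[i]^o) : set (borel G) -> R[i]^o :=
  fun A => if `[< measurable A >]
    then complex_radon_product mu nu ((fun p : G * G => (p.1 * p.2)%g) @^-1` A)
    else 0.

(* The function [convolution_fun mu nu] is a complex Radon measure with compact
   support, so that neither default value 0 of [insubd] is ever taken. *)
Definition convolution (R : realType) (G : hausdorffTopGroupType)
    (mu nu : radonMc R G) : radonMc R G :=
  insubd (0 : radonMc R G) (insubd (0 : radonM R G) (convolution_fun mu nu)).

Definition hemicompact (X : topologicalType) : Prop :=
  exists K : nat -> set X,
    [/\ forall n, compact (K n), forall n, K n `<=` K n.+1,
        \bigcup_n K n = setT &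
        forall L : set X, compact L -> exists n, L `<=` K n].

Definition spacious (G : hausdorffTopGroupType) : Prop :=
  exists A B : set G, [/\ ~ countable A, ~ countable B &
    forall K : set G, compact K ->
      finite_set [set p : G * G | [/\ A p.1, B p.2 & K (p.1 * p.2)%g]]].

(* Main.v *)
Require Import Defs.
From HB Require Import structures.
From mathcomp Require Import all_boot all_order all_algebra ring lra.
From mathcomp Require Import complex.
From mathcomp Require Import all_classical all_reals all_analysis measurable_realfun.
From mathcomp Require wochoice.
Import numFieldNormedType.Exports.
Local Open Scope classical_set_scope.
Local Open Scope ring_scope.

Set Implicit Arguments.
Unset Strict Implicit.
Unset Printing Implicit Defensive.
Import Order.TTheory GRing.Theory Num.Theory.


(** Let M_K be the space of complex Radon measures supported in the compact set K, and
M_c the union of the M_K with the locally convex direct limit topology. Convolution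
is bilinear, and it maps M_K x M_L to M_KL with |mu * nu| <= 16 |mu| |nu|
([convolution_linl], [convolution_linr], [supp_convolution], [convolution_norm]);
the constant 16 counts the pairs of Jordan parts. Both parts of the theorem follow
from these facts and a description of the neighbourhoods of 0.

The facts rest on the Radon product of two finite Radon measures m and n. It exists
([radon_product_exists]): for open U the measure n(U_x) of the section is a lower
semicontinuous function of x because n is Radon, so n(C_x) is a Borel function of x
for every Borel set C, and integrating it against m defines a Borel measure. This
measure is Radon because the function n(U_x) is approximated from below, off a set of
small m-measure, by the sections of one compact subset of U
([fibrewise_approx_level]). A complex Radon measure on the product is determined by
its values on rectangles ([complex_radon_eq0]), since compact sets are approximated by
finite unions of open rectangles. Hence the product, which is defined through the
nonlinear Jordan decomposition, is bilinear; bounds and supports are read off from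
the Jordan parts, and convolution is the image of the product under multiplication.

A convex balanced set is a neighbourhood of 0 in M_c if it contains a ball of every
M_K ([disk_nbhs0]), and these sets form a base at 0 ([radonMc_convex_nbhs]). By
bilinearity, convolution is continuous as soon as every neighbourhood U of 0
contains V * V for some neighbourhood V of 0 ([convolution_continuous]).

If G is hemicompact, with exhausting compact sets K_n, and U is convex and balanced,
choose r_n <= 1 such that the ball of radius 32 r_n in the space of measures on
K_n K_n lies in U. The product of the r_m-ball of measures on K_m and the r_n-ball of
measures on K_n then lies in U, the larger index deciding, and by bilinearity so does
V * V for V the absolutely convex hull of all these balls ([bilinear_hull]).

If G is spacious, witnessed by A and B, there is a function F on A x B that is not
dominated by any product n(a) m(b) ([undominated_product]): this holds for any two
uncountable sets, because an uncountable set contains an uncountable one ordered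
with countable initial segments, whose elements can each number their predecessors
injectively. The measures mu with |mu({ab})| F(a, b) <= 1 for all a and b form a
neighbourhood of 0, since a compact set contains only finitely many of the products
ab. A neighbourhood V of 0 contains multiples of all point masses, and if V * V
obeyed these bounds, the reciprocals of the factors would dominate F. *)

(** * Borel sets and tightness *)

Lemma hausdorff_prod (X Y : topologicalType) :
  hausdorff_space X -> hausdorff_space Y -> hausdorff_space (X * Y)%type.
Proof.
move=> hX hY [x y] [x' y'] cl; congr (_, _).
  apply: hX => A B Ax Bx.
  have [||[z ?]] := cl (A `*` setT) (B `*` setT).
  - by exists (A, setT) => //; split=> //; exact: filterT.
  - by exists (B, setT) => //; split=> //; exact: filterT.
  - by move=> [[Az _] [Bz _]]; exists z.
apply: hY => A B Ax Bx.
have [||[? z]] := cl (setT `*` A) (setT `*` B).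
- by exists (setT, A) => //; split=> //; exact: filterT.
- by exists (setT, B) => //; split=> //; exact: filterT.
- by move=> [[_ Az] [_ Bz]]; exists z.
Qed.

HB.instance Definition _ (X Y : hausdorffType) :=
  isHausdorff.Build (X * Y)%type (hausdorff_prod (@hausdorff X) (@hausdorff Y)).

Lemma continuous_borel (X Y : ptopologicalType) (f : X -> Y) (A : set (borel Y)) :
  continuous f -> measurable A -> measurable (f @^-1` A : set (borel X)).
Proof.
move=> cf mA; rewrite -[_ @^-1` _]setTI.
apply: (@measurability _ _ (borel X) (borel Y) setT f (@open Y)) => //.
move=> _ [U oU <-]; rewrite setTI; apply: sub_sigma_algebra.
by move/continuousP : cf; exact.
Qed.

Section Tight.
Context (R : realType) (X : hausdorffType).
Implicit Types (mu nu : set (borel X) -> R[i]^o) (m : {measure set (borel X) -> \bar R}).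
Local Notation tv := (@complex_variation R X).

(** For finite set functions this is inner regularity by compact sets. Bounding the
defect [A `\` K] instead of comparing [m A] with a supremum lets tightness pass to
any set function dominated by a tight one. *)
Definition tight (m : set (borel X) -> \bar R) := forall (A : set (borel X)) (e : R),
  measurable A -> 0 < e -> exists K : set (borel X),
    [/\ compact (K : set X), K `<=` A & (m (A `\` K) <= e%:E)%E].

Lemma finite_measure_fin_num m (A : set (borel X)) :
  (m setT < +oo)%E -> measurable A -> m A \is a fin_num.
Proof.
move=> fm mA; rewrite ge0_fin_numE//; apply: le_lt_trans fm.
by rewrite le_measure ?inE.
Qed.

Lemma radon_tight m : (m setT < +oo)%E -> radon m -> tight m.
Proof.
move=> fm [_ rm] A e mA e0.
have fA := finite_measure_fin_num fm mA.
have [_ [K [cK KA] <-] h] : exists2 x,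
    [set m K | K in [set K : set X | compact K /\ K `<=` A]] x & (m A - e%:E < x)%E.
  by rewrite rm//; apply: ub_ereal_sup_adherent => //; rewrite -rm.
have mK := compact_borel cK.
exists K; split=> //; rewrite measureD//; last by rewrite ltey_eq fA.
by rewrite setIidr// leeBlDr ?finite_measure_fin_num// addeC -leeBlDr// ltW.
Qed.

Lemma tight_radon m : (m setT < +oo)%E -> tight m -> radon m.
Proof.
move=> fm tm; split=> [K /compact_borel mK|A mA].
  by rewrite -ge0_fin_numE// finite_measure_fin_num.
apply/eqP; rewrite eq_le; apply/andP; split; last first.
  apply: ge_ereal_sup => _ [K [cK KA] <-].
  by rewrite le_measure ?inE//; exact: compact_borel.
apply/lee_addgt0Pr => e e0; have [K [cK KA h]] := tm A e mA e0.
have mK := compact_borel cK.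
rewrite -(setDUK KA) measureU//; [|exact: measurableD|by rewrite setDIK].
by rewrite leeD//; apply: ereal_sup_ubound; exists K.
Qed.

(** Tightness of the set function |mu| suffices: the measure that the definition of
complex Radon measures asks for is then |mu| itself. *)
Lemma tight_complex_radon mu : complex_measure mu -> (tv mu setT < +oo)%E ->
  tight (tv mu) -> complex_radon mu.
Proof.
move=> cmu fmu tmu; split=> //; have [m mE] := tv_measure_ex cmu.
have fm : (m setT < +oo)%E by rewrite mE.
exists m; split=> //; apply: tight_radon => // A e mA e0.
have [K [cK KA h]] := tmu A e mA e0; exists K; split=> //.
by rewrite mE//; apply: measurableD => //; exact: compact_borel.
Qed.

Lemma complex_radon_tight mu : complex_radon mu -> tight (tv mu).
Proof.
move=> rmu A e mA e0; have [K [cK KA h]] := complex_radon_null rmu mA e0.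
by exists K; split=> //; exact: ltW.
Qed.

Lemma tv_le0 mu (A : set (borel X)) : measurable A -> (tv mu A <= 0)%E -> mu A = 0.
Proof.
move=> mA h; apply: mod_eq0; apply/eqP; rewrite eq_le mod_ge0 andbT -lee_fin.
exact: le_trans (mod_le_tv mu mA) h.
Qed.

Lemma tv_le_measure mu m (A : set (borel X)) :
  (forall B : set (borel X), measurable B -> ((complex.Re `|mu B|)%:E <= m B)%E) ->
  measurable A -> (tv mu A <= m A)%E.
Proof.
move=> mum mA; apply: ge_ereal_sup => _ [F [mF tF FA] <-].
rewrite -FA measure_bigcup//.
rewrite [leRHS](eq_eseriesl (Q := xpredT)); last by move=> k; rewrite in_setT.
by apply: lee_nneseries => k _; [rewrite lee_fin mod_ge0|exact: mum].
Qed.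

End Tight.

(** * Sums and images of complex Radon measures *)

Section TotalVariationSum.
Context (R : realType) (X : hausdorffType).
Local Notation tv := (@complex_variation R X).

Lemma tv_sum (n : nat) (mu : 'I_n -> set (borel X) -> R[i]^o) (A : set (borel X)) :
  measurable A -> (tv (\sum_(i < n) mu i)%R A <= \sum_(i < n) tv (mu i) A)%E.
Proof.
move=> mA; elim: n mu => [|n ih] mu; first by rewrite !big_ord0 tv_cst0.
rewrite !big_ord_recr/= addrC -[X in (X + _)%R]scale1r.
apply: (le_trans (tv_lin _ _ _ mA)).
by rewrite normr1/= mul1e addeC leeD2r.
Qed.

Lemma complex_radon_sum (n : nat) (mu : 'I_n -> set (borel X) -> R[i]^o) :
  (forall i, complex_radon (mu i)) -> complex_radon (\sum_(i < n) mu i).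
Proof.
move=> rmu; elim: n mu rmu => [|n ih] mu rmu.
  by rewrite big_ord0; exact: complex_radon0.
rewrite big_ord_recr/= addrC -[X in (X + _)%R]scale1r.
by apply: complex_radon_lin => //; exact: ih.
Qed.

Lemma complex_radonZ (a : R[i]) (mu : set (borel X) -> R[i]^o) :
  complex_radon mu -> complex_radon (a *: mu).
Proof.
by move=> rmu; rewrite -[_ *: _]addr0; apply: complex_radon_lin => //; exact: complex_radon0.
Qed.

End TotalVariationSum.

Section Pushforward.
Context (R : realType) (X Y : hausdorffType) (f : X -> Y) (cf : continuous f).
Implicit Types la : set (borel X) -> R[i]^o.

Definition complex_pushforward la : set (borel Y) -> R[i]^o :=
  fun A => if `[< measurable A >] then la (f @^-1` A) else 0.

Lemma tv_pushforward la (A : set (borel Y)) : measurable A ->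
  (complex_variation (complex_pushforward la) A <= complex_variation la (f @^-1` A))%E.
Proof.
move=> mA; apply: ge_ereal_sup => _ [F [mF tF FA] <-].
apply: ereal_sup_ubound; exists (fun k => f @^-1` F k).
  split=> [k||]; first exact: continuous_borel.
    apply/trivIsetP => i j _ _ ij; move/trivIsetP : tF => /(_ i j I I ij) Fij.
    by rewrite -preimage_setI Fij preimage_set0.
  by rewrite -FA preimage_bigcup.
apply: eq_eseriesr => k _; rewrite /complex_pushforward asboolT//.
Qed.

(** If [K] is a compact subset of [f @^-1` A] that carries almost all of the variation
there, then [f @` K] does so in [A]; the preimage of [A `\` f @` K] avoids [K]. *)
Lemma complex_radon_pushforward la :
  complex_radon la -> complex_radon (complex_pushforward la).
Proof.
move=> rla.
have tvm := tv_pushforward la.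
apply: tight_complex_radon.
- split=> [A nmA|F mF tF]; first by rewrite /complex_pushforward asboolF.
  have mF' k : measurable (f @^-1` F k : set (borel X)) by exact: continuous_borel.
  rewrite /complex_pushforward asboolT; last exact: bigcupT_measurable.
  rewrite preimage_bigcup.
  under eq_fun do under eq_bigr do rewrite asboolT//.
  apply: rla.1.2 => //; apply/trivIsetP => i j _ _ ij.
  move/trivIsetP : tF => /(_ i j I I ij) Fij.
  by rewrite -preimage_setI Fij preimage_set0.
- apply: le_lt_trans (tvm _ measurableT) _.
  by rewrite preimage_setT -ge0_fin_numE ?tv_ge0// tv_fin.
- move=> A e mA e0.
  have mfA : measurable (f @^-1` A : set (borel X)) by exact: continuous_borel.
  have [K [cK KA h]] := complex_radon_tight rla mfA e0.
  have cfK : compact (f @` K : set Y).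
    by apply: continuous_compact => //; exact: continuous_subspaceT.
  have mfK := compact_borel cfK.
  exists (f @` K : set Y); split=> // [y [x Kx <-]|]; first exact: KA.
  have mD : measurable (A `\` f @` K : set (borel Y)) by exact: measurableD.
  apply: le_trans (tvm _ mD) _; apply: le_trans h; apply: tv_mono => //.
  + exact: continuous_borel.
  + by apply: measurableD => //; exact: compact_borel.
  + by move=> x [/= Afx nK]; split=> // Kx; apply: nK; exists x.
Qed.

End Pushforward.

Section RealParts.
Context (R : realType).

Lemma ReD (x y : R[i]) : complex.Re (x + y) = complex.Re x + complex.Re y.
Proof. by case: x; case: y. Qed.

Lemma ReN (x : R[i]) : complex.Re (- x) = - complex.Re x.
Proof. by case: x. Qed.

Lemma Re_sum (n : nat) (z : nat -> R[i]) :
  complex.Re (\sum_(0 <= k < n) z k) = \sum_(0 <= k < n) complex.Re (z k).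
Proof.
elim: n => [|n ih]; first by rewrite !big_geq.
by rewrite !big_nat_recr//= ReD ih.
Qed.

Lemma le_Re_mod (z : R[i]) : `|complex.Re z| <= complex.Re `|z|.
Proof.
rewrite normc_def/=; case: z => a b /=.
by rewrite -sqrtr_sqr ler_wsqrtr// lerDl sqr_ge0.
Qed.

Lemma cvg_Re (u : nat -> R[i]^o) (l : R[i]^o) : u @ \oo --> l ->
  (fun n => complex.Re (u n)) @ \oo --> complex.Re l.
Proof.
move=> /cvgrPdist_lt ul; apply/cvgrPdist_lt => e e0.
have e0C : 0 < e%:C%C :> R[i] by rewrite (ltcR 0).
have := ul _ e0C; apply: filterS => n; rewrite modE ltcR => h.
apply: le_lt_trans h; apply: le_trans (le_Re_mod _).
by case: (l) (u n) => [a b] [c d].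
Qed.

Lemma cvg_complex (u : nat -> R) (l : R) : u @ \oo --> l ->
  (fun n => (u n)%:C%C : R[i]^o) @ \oo --> (l%:C%C : R[i]^o).
Proof.
move=> /cvgrPdist_lt ul; apply/cvgrPdist_lt => -[e e'] /=.
rewrite ltcE/= => /andP[/eqP e'0 e0].
have := ul _ e0; apply: filterS => n h.
rewrite -rmorphB/= normc_def/= expr0n addr0 sqrtr_sqr ltcE/= h andbT.
by rewrite -e'0.
Qed.

End RealParts.

Section ComplexOfMeasure.
Context (R : realType) (X : hausdorffType).
Variable m : {measure set (borel X) -> \bar R}.
Hypotheses (fm : (m setT < +oo)%E).

(** The cut-off off the Borel sets makes equality of complex measures equality of
functions. *)
Definition complex_of_measure : set (borel X) -> R[i]^o :=
  fun A => if `[< measurable A >] then (fine (m A))%:C%C else 0.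

Lemma tv_complex_of_measure (A : set (borel X)) : measurable A ->
  (complex_variation complex_of_measure A <= m A)%E.
Proof.
apply: tv_le_measure => B mB; rewrite /complex_of_measure asboolT//.
rewrite normc_def/= expr0n addr0 sqrtr_sqr ger0_norm ?fine_ge0//.
by rewrite fineK// finite_measure_fin_num.
Qed.

Lemma complex_measure_of_measure : complex_measure complex_of_measure.
Proof.
split=> [A nmA|F mF tF]; first by rewrite /complex_of_measure asboolF.
have mUF := bigcupT_measurable F mF.
rewrite /complex_of_measure asboolT//.
rewrite (_ : (fun n => _) = (fun n => (\sum_(0 <= k < n) fine (m (F k)))%:C%C : R[i]^o)).
  apply: cvg_complex.
  have := @measure_semi_sigma_additive _ _ _ m F mF tF mUF.
  rewrite -(fineK (finite_measure_fin_num fm mUF)) => /fine_cvgP[_].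
  rewrite (_ : fine \o _ = (fun n => \sum_(0 <= k < n) fine (m (F k))))//.
  apply/funext => n /=; rewrite sum_fine// => k _.
  exact: finite_measure_fin_num.
by apply/funext => n; rewrite rmorph_sum/=; apply: eq_bigr => k _; rewrite asboolT.
Qed.

Lemma complex_radon_of_measure : radon m -> complex_radon complex_of_measure.
Proof.
move=> /(radon_tight fm) tm; apply: tight_complex_radon.
- exact: complex_measure_of_measure.
- exact: le_lt_trans (tv_complex_of_measure measurableT) fm.
- move=> A e mA e0; have [K [cK KA h]] := tm A e mA e0; exists K; split=> //.
  apply: le_trans (tv_complex_of_measure _) h.
  by apply: measurableD => //; exact: compact_borel.
Qed.

End ComplexOfMeasure.

(** * The Jordan decomposition *)

Section PositivePart.
Context (R : realType) (X : hausdorffType).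
Implicit Types mu : set (borel X) -> R[i]^o.
Local Notation tv := (@complex_variation R X).

(** The positive part of the real measure [Re mu]. All four Jordan parts are of this
form, for a multiple of [mu] by a power of -i. *)
Definition positive_part mu (A : set (borel X)) : \bar R :=
  ereal_sup [set (complex.Re (mu B : R[i]))%:E | B in
    [set B : set (borel X) | measurable B /\ B `<=` A]].

Lemma jordan_partE j mu : jordan_part j mu = positive_part ((- 'i%C) ^+ j *: mu).
Proof. by []. Qed.

Lemma positive_part_ge mu (A B : set (borel X)) : measurable B -> B `<=` A ->
  ((complex.Re (mu B : R[i]))%:E <= positive_part mu A)%E.
Proof. by move=> mB BA; apply: ereal_sup_ubound; exists B. Qed.

Lemma positive_part_ge0 mu (A : set (borel X)) : complex_measure mu ->
  (0 <= positive_part mu A)%E.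
Proof.
move=> cmu; have := @positive_part_ge mu A set0 measurable0 (@sub0set _ _).
by rewrite complex_measure0.
Qed.

Lemma positive_part_le_tv mu (A : set (borel X)) : complex_radon mu ->
  measurable A -> (positive_part mu A <= tv mu A)%E.
Proof.
move=> rmu mA; apply: ge_ereal_sup => _ [B [mB BA] <-].
apply: le_trans (tv_mono rmu mB mA BA); apply: le_trans (mod_le_tv mu mB).
by rewrite lee_fin; apply: le_trans (le_Re_mod _); exact: ler_norm.
Qed.

Lemma positive_part_fin mu (A : set (borel X)) : complex_radon mu ->
  measurable A -> positive_part mu A \is a fin_num.
Proof.
move=> rmu mA; rewrite ge0_fin_numE ?positive_part_ge0//; last exact: rmu.1.
apply: le_lt_trans (positive_part_le_tv rmu mA) _.
by rewrite -ge0_fin_numE ?tv_ge0// tv_fin.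
Qed.

Lemma complex_measureU mu (A B : set (borel X)) : complex_measure mu ->
  measurable A -> measurable B -> A `&` B = set0 -> mu (A `|` B) = mu A + mu B.
Proof.
move=> cmu mA mB AB0.
have mAB k : measurable (bigcup2 A B k : set (borel X)).
  by rewrite /bigcup2; do 2!case: ifP => // _.
have tAB : trivIset setT (bigcup2 A B) by rewrite -trivIset_bigcup2.
have := cmu.2 _ mAB tAB; rewrite bigcup2E => h.
have h2 : (fun n => \sum_(0 <= k < n) mu (bigcup2 A B k)) @ \oo --> mu A + mu B.
  apply: cvg_near_cst; exists 2%N => // n /= n2.
  rewrite big_ltn ?(leq_trans _ n2)// big_ltn//= big_nat_cond big1 ?addr0// => k.
  by rewrite andbT; case: k => [|[|k]]//= _; exact: complex_measure0.
exact: (cvg_unique (@norm_hausdorff _ R[i]^o) h h2).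
Qed.

(** Near-optimal subsets of [A] and of [B] are disjoint, so their union competes in
the supremum for [A `|` B]. *)
Lemma positive_part_additive2 mu (A B : set (borel X)) : complex_radon mu ->
  measurable A -> measurable B -> A `&` B = set0 ->
  (positive_part mu A + positive_part mu B <= positive_part mu (A `|` B))%E.
Proof.
move=> rmu mA mB AB0.
apply/lee_addgt0Pr => e e0.
have e20 : 0 < e / 2 by rewrite divr_gt0.
have [_ [C [mC CA] <-] hC] := ub_ereal_sup_adherent e20 (positive_part_fin rmu mA).
have [_ [D [mD DB] <-] hD] := ub_ereal_sup_adherent e20 (positive_part_fin rmu mB).
rewrite -/(positive_part mu A) in hC; rewrite -/(positive_part mu B) in hD.
apply: (@le_trans _ _ (((complex.Re (mu C))%:E + (e/2)%:E) +
    ((complex.Re (mu D))%:E + (e/2)%:E))%E).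
  by rewrite leeD// -leeBlDr// ltW.
rewrite addeACA -!EFinD -splitr EFinD leeD2r// -ReD -complex_measureU//.
- apply: positive_part_ge; first exact: measurableU.
  exact: setUSS.
- exact: rmu.1.
- by rewrite -subset0 -AB0; exact: setISS.
Qed.

Lemma positive_part_mono mu (A B : set (borel X)) : A `<=` B ->
  (positive_part mu A <= positive_part mu B)%E.
Proof.
move=> AB; apply: ge_ereal_sup => _ [C [mC CA] <-].
by apply: positive_part_ge => //; exact: subset_trans AB.
Qed.

(** Any competitor [B] for the union is cut into the pieces [B `&` F k], each of which
competes for [F k]; conversely finite superadditivity bounds the partial sums. *)
Lemma positive_part_sigma mu (F : nat -> set (borel X)) : complex_radon mu ->
  (forall k, measurable (F k)) -> trivIset setT F ->
  positive_part mu (\bigcup_k F k) = (\sum_(0 <= k <oo) positive_part mu (F k))%E.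
Proof.
move=> rmu mF tF; have cmu := rmu.1.
have F0 k : (0 <= positive_part mu (F k))%E by exact: positive_part_ge0.
apply/eqP; rewrite eq_le; apply/andP; split.
  apply: ge_ereal_sup => _ [B [mB BF] <-].
  have : B = \bigcup_k (B `&` F k) by rewrite -setI_bigcupr setIidl.
  move=> BE; have cvB : (fun n => \sum_(0 <= k < n) mu (B `&` F k)) @ \oo --> mu B.
    rewrite [X in _ --> mu X]BE; apply: cmu.2 => [k|]; first exact: measurableI.
    exact: trivIset_setIl.
  have S0 : (0 <= \sum_(0 <= k <oo) positive_part mu (F k))%E by exact: nneseries_ge0.
  case S : (\sum_(0 <= k <oo) positive_part mu (F k))%E S0 => [s| |]// _.
    rewrite lee_fin -(cvg_lim (@Rhausdorff R) (cvg_Re cvB)).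
    apply: limr_le; first exact: cvgP (cvg_Re cvB).
    apply: nearW => n; rewrite Re_sum -lee_fin -S -sumEFin.
    apply: le_trans (@nneseries_lim_ge R _ xpredT 0%N n (fun k _ _ => F0 k)).
    apply: lee_sum => k _; apply: positive_part_ge; first exact: measurableI.
    exact: subIsetr.
  by rewrite leey.
apply: lime_le; first exact: is_cvg_nneseries.
apply: nearW => n.
have mU k : measurable (\big[setU/set0]_(i < k) F i : set (borel X)).
  by apply: bigsetU_measurable.
apply: (@le_trans _ _ (positive_part mu (\big[setU/set0]_(i < n) F i))); last first.
  by apply: positive_part_mono; rewrite -bigcup_mkord => x [k _ Fx]; exists k.
elim: n => [|n ih]; first by rewrite big_geq// positive_part_ge0.
rewrite big_nat_recr//= big_ord_recr/=.
apply: le_trans (positive_part_additive2 rmu (mU n) (mF n) _).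
  by rewrite leeD2r.
apply: (@trivIset_bigsetUI _ xpredT) => //.
by move=> i j _ _; exact: tF.
Qed.

(** The positive part is at most |mu|, hence inherits finiteness and tightness. *)
Lemma positive_part_measure mu : complex_radon mu ->
  exists m : {measure set (borel X) -> \bar R},
    [/\ forall A : set (borel X), measurable A -> m A = positive_part mu A,
        radon m & (m setT < +oo)%E].
Proof.
move=> rmu; have cmu := rmu.1.
pose f (A : set (borel X)) := if `[< measurable A >] then positive_part mu A else 0%E.
have fE A : measurable A -> f A = positive_part mu A by move=> mA; rewrite /f asboolT.
have f0 : f set0 = 0%E.
  rewrite fE//; apply/eqP; rewrite eq_le positive_part_ge0// andbT.
  by apply: le_trans (positive_part_le_tv rmu measurable0) _; rewrite tv0.
have f_ge0 A : (0 <= f A)%E.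
  by rewrite /f; case: ifPn => // _; exact: positive_part_ge0.
have f_sigma : semi_sigma_additive f.
  move=> F mF tF mUF; rewrite fE// positive_part_sigma//.
  rewrite (eq_eseriesr (g := f \o F)); last by move=> k _; rewrite /= fE.
  exact: is_cvg_nneseries.
pose m : {measure set (borel X) -> \bar R} :=
  HB.pack f (isMeasure.Build _ _ _ f f0 f_ge0 f_sigma).
have fm : (m setT < +oo)%E.
  by rewrite /m/= fE// -ge0_fin_numE ?positive_part_ge0// positive_part_fin.
exists m; split=> //; apply: tight_radon => // A e mA e0.
have [K [cK KA h]] := complex_radon_tight rmu mA e0; exists K; split=> //.
have mD : measurable (A `\` K) by apply: measurableD => //; exact: compact_borel.
by apply: le_trans h; rewrite /m/= fE// positive_part_le_tv.
Qed.

(** Passing from [B] to [A `\` B] turns the supremum of [- Re mu] over the subsets of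
[A] into the supremum of [Re mu] minus [Re (mu A)]. *)
Lemma positive_partB mu (A : set (borel X)) : complex_radon mu -> measurable A ->
  fine (positive_part mu A) - fine (positive_part (- mu) A) = complex.Re (mu A : R[i]).
Proof.
move=> rmu mA.
have rN : complex_radon (- mu) by rewrite -scaleN1r; exact: complex_radonZ.
have key nu : complex_radon nu ->
    (positive_part nu A - (complex.Re (nu A : R[i]))%:E <= positive_part (- nu)%R A)%E.
  move=> rnu; rewrite leeBlDr//; apply: ge_ereal_sup => _ [B [mB BA] <-].
  rewrite -leeBlDr// -EFinB.
  have -> : complex.Re (nu B) - complex.Re (nu A) = complex.Re ((- nu) (A `\` B) : R[i]).
    have mAB : measurable (A `\` B) by exact: measurableD.
    rewrite -[in nu A](setDUK BA) complex_measureU//; last first.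
    - by rewrite setDIK.
    - exact: rnu.1.
    have -> : (- nu) (A `\` B) = - nu (A `\` B) by [].
    by rewrite ReD ReN opprD addrA subrr sub0r.
  by apply: positive_part_ge; [exact: measurableD|exact: subDsetl].
have h1 := key _ rmu; have h2 := key _ rN; rewrite opprK in h2.
have f1 := positive_part_fin rmu mA; have f2 := positive_part_fin rN mA.
move: h1 h2; rewrite -(fineK f1) -(fineK f2) -!EFinB !lee_fin.
have -> : complex.Re ((- mu) A : R[i]) = - complex.Re (mu A).
  by rewrite -ReN.
lra.
Qed.

End PositivePart.

Section JordanParts.
Context (R : realType) (X : hausdorffType).
Implicit Types mu : set (borel X) -> R[i]^o.

Lemma complex_mod_i j : complex.Re `|((- 'i%C) ^+ j : R[i])| = 1.
Proof.
rewrite normrX normrN; have -> : `|'i%C : R[i]| = 1.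
  by rewrite normc_def/= expr0n expr1n add0r sqrtr1.
by rewrite expr1n.
Qed.

Lemma jordan_part_measure j mu : complex_radon mu ->
  exists m : {measure set (borel X) -> \bar R},
    [/\ forall A : set (borel X), measurable A -> m A = jordan_part j mu A,
        radon m, (m setT < +oo)%E &
        forall A : set (borel X), measurable A -> (m A <= complex_variation mu A)%E].
Proof.
move=> rmu; have rj := complex_radonZ ((- 'i%C) ^+ j) rmu.
have [m [mE rm fm]] := positive_part_measure rj; exists m; split=> // A mA.
rewrite mE//; apply: le_trans (positive_part_le_tv rj mA) _.
by rewrite tvZ// complex_mod_i mul1e.
Qed.

Lemma jordan_decomposition mu (A : set (borel X)) : complex_radon mu -> measurable A ->
  mu A = \sum_(j < 4) 'i%C ^+ j * (fine (jordan_part j mu A))%:C%C.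
Proof.
move=> rmu mA; rewrite !big_ord_recr big_ord0/= !jordan_partE.
have rj j := complex_radonZ ((- 'i%C) ^+ j) rmu.
have i2 : 'i%C * 'i%C = -1 :> R[i] by rewrite -expr2 sqr_i.
have h0 := positive_partB (rj 0) mA; have h1 := positive_partB (rj 1) mA.
(* The parts 2 and 3 are the positive parts of the opposites of those for 0 and 1. *)
have e2 : (- 'i%C) ^+ 2 *: mu = - ((- 'i%C) ^+ 0 *: mu).
  by rewrite expr2 mulrNN i2 expr0 scaleN1r scale1r.
have e3 : (- 'i%C) ^+ 3 *: mu = - ((- 'i%C) ^+ 1 *: mu).
  by rewrite exprSr expr2 mulrNN i2 mulN1r opprK expr1 scaleNr opprK.
have m0 : ((- 'i%C) ^+ 0 *: mu) A = mu A by rewrite expr0 scale1r.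
have m1 : ((- 'i%C) ^+ 1 *: mu) A = - 'i%C * mu A by rewrite expr1.
rewrite m0 in h0; rewrite m1 in h1; rewrite e2 e3.
move: h0 h1.
move: (fine _) (fine _) (fine _) (fine _) => a b c d.
case: (mu A) => x y /= ab cd.
have -> : 'i%C ^+ 3 = - 'i%C :> R[i] by rewrite exprS expr2 i2 mulrN1.
rewrite expr0 expr1 expr2 i2; apply/eqP; rewrite eq_complex/=.
by apply/andP; split; apply/eqP; lra.
Qed.

End JordanParts.

(** * Existence of the Radon product *)

Section OpenTight.
Context (R : realType) (X : hausdorffType).
Variable m : {measure set (borel X) -> \bar R}.
Hypothesis fm : (m setT < +oo)%E.

Let sandwiched : set (set (borel X)) := [set A | measurable A /\
  forall e : R, 0 < e -> exists K W : set (borel X),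
    [/\ compact (K : set X), open (W : set X), K `<=` A, A `<=` W & (m (W `\` K) <= e%:E)%E]].

(** The Borel sets that can be squeezed between a compact and an open set of nearly
equal measure form a sigma-algebra. It contains the open sets by hypothesis. For
complements, compactness is regained by intersecting with a compact set that carries
almost the whole mass, itself given by the hypothesis for the whole space. *)
Lemma open_tight : (forall (U : set X) (e : R), open U -> 0 < e ->
    exists K : set (borel X), [/\ compact (K : set X), K `<=` U & (m (U `\` K) <= e%:E)%E]) ->
  tight m.
Proof.
move=> oreg.
suff sand : measurable `<=` sandwiched.
  move=> A e /sand[mA AP] e0; have [K [W [cK oW KA AW h]]] := AP e e0.
  exists K; split=> //.
  apply: le_trans h; apply: le_measure; rewrite ?inE.
  - by apply: measurableD => //; exact: compact_borel.
  - by apply: measurableD; [exact: open_borel|exact: compact_borel].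
  - exact: setSD.
apply: smallest_sub; last first.
  move=> U oU; split; first exact: open_borel.
  by move=> e e0; have [K [cK KU h]] := oreg U e oU e0; exists K, U; split.
split.
- split=> // e e0; exists set0, set0; split=> //; first exact: compact0.
    exact: open0.
  by rewrite setD0 measure0 lee_fin ltW.
- move=> A [mA AP]; rewrite setTD; split; first exact: measurableC.
  move=> e e0; have e20 : 0 < e / 2 by rewrite divr_gt0.
  have [K [W [cK oW KA AW h]]] := AP _ e20.
  have [Q [cQ _ hQ]] := oreg _ _ openT e20.
  have mK := compact_borel cK; have mQ := compact_borel cQ; have mW := open_borel oW.
  exists (Q `\` W), (~` K); split.
  + rewrite setDE; apply: compact_closedI => //; exact: open_closedC.
  + by apply: closed_openC; apply: compact_closed cK; exact: hausdorff.
  + by move=> x [_ nW] /AW.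
  + exact: subsetC.
  + rewrite [e]splitr EFinD; apply: le_trans (leeD h hQ).
    have m1 : measurable (W `\` K) by exact: measurableD.
    have m2 : measurable (setT `\` Q) by exact: measurableD.
    apply: le_trans (measureU2 _ m1 m2).
    apply: le_measure; rewrite ?inE.
    * by apply: measurableD; [exact: measurableC|exact: measurableD].
    * exact: measurableU.
    * move=> x [nK nQW]; have [Wx|nWx] := pselect (W x); first by left.
      by right; split=> // Qx; apply: nQW.
- move=> A AP.
  have mA k : measurable (A k : set (borel X)) by have [] := AP k.
  split; first exact: (bigcupT_measurable (A : nat -> set (borel X))).
  move=> e e0; have e20 : 0 < e / 2 by rewrite divr_gt0.
  have en k : 0 < (e / 2) / (2 ^ k.+1)%:R by rewrite divr_gt0// ltr0n expn_gt0.
  have /choice[KW] : forall k, exists KW : set (borel X) * set (borel X),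
    [/\ compact (KW.1 : set X), open (KW.2 : set X), KW.1 `<=` A k, A k `<=` KW.2 &
        (m (KW.2 `\` KW.1) <= ((e / 2) / (2 ^ k.+1)%:R)%:E)%E].
    move=> k; have [_ /(_ _ (en k))[K [W h]]] := AP k; by exists (K, W).
  move=> /all_and5[cK oW KA AW h].
  have mK k := compact_borel (cK k); have mW k := open_borel (oW k).
  (* The union of all the compact sets need not be compact: only finitely many of
     them are kept, at the cost of the second half of [e]. *)
  pose W := \bigcup_k (KW k).2; pose C := \bigcup_k (KW k).1.
  pose F n := \big[setU/set0]_(k < n) (KW k).1.
  have FE n : F n = \bigcup_(k in `I_n) (KW k).1 by rewrite bigcup_mkord.
  have cF n : compact (F n : set X) by apply: bigsetU_compact.
  have mF n := compact_borel (cF n).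
  have mW' : measurable (W : set (borel X)) by exact: bigcupT_measurable.
  have mC : measurable (C : set (borel X)) by exact: bigcupT_measurable.
  have mWC : measurable (W `\` C : set (borel X)) by exact: measurableD.
  have mWF n : measurable (W `\` F n : set (borel X)) by exact: measurableD.
  have WC : (m (W `\` C) <= (e/2)%:E)%E.
    apply: (@le_trans _ _ (\sum_(0 <= k <oo) m ((KW k).2 `\` (KW k).1)))%E.
      apply: measure_sigma_subadditive => // [k|x [[k _ Ok] nC]].
        exact: measurableD.
      by exists k => //; split=> // Kk; apply: nC; exists k.
    apply: le_trans (epsilon_trick0 xpredT (ltW e20)).
    by apply: lee_nneseries.
  have cv : m (W `\` F n) @[n --> \oo] --> m (W `\` C).
    have -> : W `\` C = \bigcap_n (W `\` F n).
      apply/seteqP; split=> [x [Wx nC] n _|x xF].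
        by split=> //; rewrite FE => -[k _ Kx]; apply: nC; exists k.
      have [Wx _] := xF 0%N I; split=> // -[k _ Kx].
      have [_] := xF k.+1 I; apply; rewrite FE.
      by exists k => //=.
    apply: nonincreasing_cvg_mu => //.
    - by rewrite -ge0_fin_numE// finite_measure_fin_num.
    - exact: bigcapT_measurable.
    - move=> a b ab; apply/subsetPset; apply: setDS; rewrite !FE.
      by move=> x [k /= ka Kx]; exists k => //=; exact: leq_trans ab.
  have : (\forall n \near \oo, m (W `\` F n) < e%:E)%E.
    have : (m (W `\` C) < e%:E)%E.
      by apply: le_lt_trans WC _; rewrite lte_fin gtr_pMr// invf_lt1// ltr1n.
    move=> lt; apply: (cv [set y | (y < e%:E)%E]); apply: open_nbhs_nbhs.
    by split=> //; exact: open_ereal_lt_ereal.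
  move=> [n _ /(_ n (leqnn n))/= hn]; exists (F n), W; split=> //.
  - exact: bigcup_open.
  - by rewrite FE => x [k _ Kx]; exists k => //; exact: KA.
  - by move=> x [k _ Ax]; exists k => //; exact: AW.
  - exact: ltW.
Qed.

End OpenTight.

Section Sections.
Context (R : realType) (X Y : hausdorffType).
Variable n : {measure set (borel Y) -> \bar R}.
Hypotheses (fn : (n setT < +oo)%E) (rn : radon n).
Local Notation XY := (X * Y)%type.

Lemma continuous_pairr (x : X) : continuous (fun y : Y => (x, y)).
Proof. by move=> y; apply: cvg_pair => /=; [exact: cvg_cst|exact: cvg_id]. Qed.

Lemma borel_xsection (x : X) (C : set (borel XY)) : measurable C ->
  measurable (xsection C x : set (borel Y)).
Proof.
by move=> mC; rewrite xsectionE; apply: continuous_borel => //; exact: continuous_pairr.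
Qed.

(** Inner regularity replaces the section by a compact set of measure above [q], and
the tube lemma thickens the point [x]. This is where the Radon property makes
[fun x => n (xsection U x)] lower semicontinuous. *)
Lemma open_xsection_tube (U : set XY) (x : X) (q : R) : open U ->
  (q%:E < n (xsection U x))%E ->
  exists N : set X, exists2 L : set Y, [/\ open N, N x & compact L] &
    N `*` L `<=` U /\ (q%:E < n L)%E.
Proof.
move=> oU qU; have mU := borel_xsection x (open_borel oU).
move: qU; rewrite rn.2// => /ereal_sup_gt[_ [L [cL LU] <-] qL].
have : \forall x' \near x, L `<=` (fun y => U (x', y)).
  move/compact_near_coveringP : cL => cL.
  apply: (cL X (nbhs x) (fun x' y => U (x', y))) => y /LU /xsectionP Uxy.
  have /nbhs_interior : nbhs (x, y) U by apply: open_nbhs_nbhs.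
  move=> /nbhs_singleton [[V W] [/= Vx Wy] VW].
  by exists (W, V) => // -[y' x'] [/= Wy' Vx']; exact: (VW (x', y')).
rewrite /prop_near1 nbhsE => -[N [oN Nx] NL]; exists N, L; split=> //.
by move=> [x' y'] [/= Nx' Ly']; exact: NL.
Qed.

Lemma open_section_level (U : set XY) (q : R) : open U ->
  open [set x | (q%:E < n (xsection U x))%E].
Proof.
move=> oU; rewrite openE => x /= qx.
have [N [L [oN Nx cL] [NL qL]]] := open_xsection_tube oU qx.
apply: (@filterS _ _ _ N); last exact: open_nbhs_nbhs.
move=> x' Nx' /=; apply: lt_le_trans qL _; apply: le_measure; rewrite ?inE.
- exact: compact_borel.
- by apply: borel_xsection; exact: open_borel.
- by move=> y Ly; apply/xsectionP; apply: NL.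
Qed.

(** The Borel sets of the product may exceed the product of the Borel
sigma-algebras, so sections of rectangles do not suffice: the Dynkin argument
starts from open sets, for which the function is lower semicontinuous. *)
Lemma borel_fun_section (C : set (borel XY)) : measurable C ->
  measurable_fun setT ((fun x => n (xsection C x)) : borel X -> \bar R).
Proof.
apply: (@dynkin_induction _ (borel XY) (@open XY)
  (fun C => measurable_fun setT ((fun x => n (xsection C x)) : borel X -> \bar R))) => //.
- by move=> U V oU oV; exact: openI.
- rewrite (_ : (fun x => _) = cst (n setT))//.
  by apply/funext => x; congr (n _); apply/seteqP; split=> // y _; apply/xsectionP.
- move=> U oU; apply: (measurability _ (ErealGenOInfty.measurableE R)).
  move=> /= _ [_ [q ->]] <-; apply: measurableI => //.
  by rewrite preimage_itvoy; apply: open_borel; exact: open_section_level.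
- move=> S mS mfS.
  rewrite (_ : (fun x => _) = (fun x => n setT - n (xsection S x))%E).
    exact: emeasurable_funB.
  apply/funext => x; have mSx := borel_xsection x mS.
  rewrite -[xsection S x]setTI -measureD//; congr (n _).
  apply/seteqP; split=> [y /xsectionP Sy|y [_ Sy]].
    by split=> // /xsectionP.
  by apply/xsectionP => ?; apply: Sy; apply/xsectionP.
- move=> F mF tF mfF.
  rewrite (_ : (fun x => _) = (fun x => \sum_(0 <= k <oo) n (xsection (F k) x))%E).
    by apply: ge0_emeasurable_sum.
  apply/funext => x; rewrite xsection_bigcup measure_semi_bigcup//.
  - by move=> k; exact: borel_xsection.
  - exact: trivIset_xsection.
  - by apply: bigcupT_measurable => k; exact: borel_xsection.
Qed.

(** Countable additivity in [C] passes through the sections by monotone convergence. *)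
Lemma section_measure (m : {measure set (borel X) -> \bar R}) :
  exists rho : {measure set (borel XY) -> \bar R}, forall C : set (borel XY),
    rho C = (\int[m]_x n (xsection C x))%E.
Proof.
pose f (C : set (borel XY)) := (\int[m]_x n (xsection C x))%E.
have f0 : f set0 = 0%E by rewrite /f integral0_eq// => x _; rewrite xsection0.
have f_ge0 C : (0 <= f C)%E by exact: integral_ge0.
have f_sigma : semi_sigma_additive f.
  move=> F mF tF mUF.
  rewrite [X in _ --> X](_ : _ = \sum_(0 <= k <oo) f (F k))%E.
    exact: is_cvg_nneseries.
  rewrite /f -integral_nneseries//; last by move=> k; exact: borel_fun_section.
  apply: eq_integral => x _; rewrite xsection_bigcup measure_semi_bigcup//.
  - by move=> k; exact: borel_xsection.
  - exact: trivIset_xsection.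
  - by apply: bigcupT_measurable => k; exact: borel_xsection.
pose rho : {measure set (borel XY) -> \bar R} :=
  HB.pack f (isMeasure.Build _ _ _ f f0 f_ge0 f_sigma).
by exists rho.
Qed.

End Sections.

Section SectionRegularity.
Context (R : realType) (X Y : hausdorffType).
Variables (m : {measure set (borel X) -> \bar R}) (n : {measure set (borel Y) -> \bar R}).
Hypotheses (fm : (m setT < +oo)%E) (rm : radon m) (fn : (n setT < +oo)%E) (rn : radon n).
Local Notation XY := (X * Y)%type.
Variable U : set XY.
Hypothesis oU : open U.

(** One compact subset [C] of [U] has large sections over all of [E], up to a set [B]
of small measure. The exceptional set makes the property stable under unions and
lets tubes be cut down to compact ones by inner regularity of [m]. *)
Definition fibrewise_approx (q : R) (E : set X) := forall e : R, 0 < e ->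
  exists C : set XY, exists2 B : set (borel X),
    [/\ compact C, C `<=` U, measurable B & (m B <= e%:E)%E] &
    forall x, E x -> ~ B x -> (q%:E < n (xsection C x))%E.

Lemma le_section (C D : set XY) (x : X) : measurable (C : set (borel XY)) ->
  measurable (D : set (borel XY)) -> C `<=` D ->
  (n (xsection C x) <= n (xsection D x))%E.
Proof.
move=> mC mD CD; apply: le_measure; rewrite ?inE; [exact: borel_xsection..|].
exact: le_xsection.
Qed.

Lemma fibrewise_approxU (q : R) (E F : set X) :
  fibrewise_approx q E -> fibrewise_approx q F -> fibrewise_approx q (E `|` F).
Proof.
move=> aE aF e e0; have e20 : 0 < e / 2 by rewrite divr_gt0.
have [C1 [B1 [cC1 C1U mB1 hB1] h1]] := aE _ e20.
have [C2 [B2 [cC2 C2U mB2 hB2] h2]] := aF _ e20.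
have mC1 := compact_borel cC1; have mC2 := compact_borel cC2.
have mC := measurableU _ _ mC1 mC2.
exists (C1 `|` C2), (B1 `|` B2).
  split; [exact: compactU|by rewrite subUset|exact: measurableU|].
  rewrite [e]splitr EFinD; apply: le_trans (leeD hB1 hB2).
  exact: measureU2.
move=> x [Ex|Fx] nB.
  apply: lt_le_trans (h1 x Ex _) _; first by move=> ?; apply: nB; left.
  by apply: le_section => // z; left.
apply: lt_le_trans (h2 x Fx _) _; first by move=> ?; apply: nB; right.
by apply: le_section => // z; right.
Qed.

Lemma fibrewise_approx_tube (q : R) (N : set X) (L : set Y) :
  open N -> compact L -> N `*` L `<=` U -> (q%:E < n L)%E -> fibrewise_approx q N.
Proof.
move=> oN cL NLU qL e e0.
have [K [cK KN h]] := radon_tight fm rm (open_borel oN) e0.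
exists (K `*` L), (N `\` K).
  split=> //; first exact: compact_setX.
    by move=> [x y] [/= /KN Nx Ly]; exact: NLU.
  by apply: measurableD; [exact: open_borel|exact: compact_borel].
move=> x Nx nNK; have Kx : K x by apply: contrapT => nKx; apply: nNK.
by rewrite in_xsectionX// inE.
Qed.

(** The level set is open, hence almost exhausted by a compact set, and that compact
set is covered by finitely many of the tubes of [open_xsection_tube]. *)
Lemma fibrewise_approx_level (q : R) :
  fibrewise_approx q [set x | (q%:E < n (xsection U x))%E].
Proof.
set E := [set x | _].
have mE : measurable (E : set (borel X)).
  by apply: open_borel; exact: open_section_level.
have compactE (K : set X) : compact K -> K `<=` E -> fibrewise_approx q K.
  move=> cK KE.
  have /choice[NL NLP] : forall x, exists NL : set X * set Y, E x ->
      [/\ open NL.1, NL.1 x, compact NL.2, NL.1 `*` NL.2 `<=` U & (q%:E < n NL.2)%E].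
    move=> x; have [Ex|nEx] := pselect (E x); last by exists (set0, set0).
    by have [N [L [? ? ?] [? ?]]] := open_xsection_tube rn oU Ex; exists (N, L).
  have := cK; rewrite compact_cover => /(_ X K (fun x => (NL x).1)).
  case=> [x /KE /NLP[]//|x Kx|D DK KD].
    by exists x => //; have [] := NLP x (KE x Kx).
  have : forall s : seq X, (forall x, x \in s -> K x) ->
      fibrewise_approx q (\big[setU/set0]_(x <- s) (NL x).1).
    elim=> [_|x s ih sK].
      rewrite big_nil => e e0; exists set0, set0 => //; split=> //.
      - exact: compact0.
      - by rewrite measure0 lee_fin ltW.
    rewrite big_cons => e e0.
    have [oN _ cL NLU qL] := NLP x (KE x (sK x (mem_head _ _))).
    have a1 := fibrewise_approx_tube oN cL NLU qL.
    have a2 : fibrewise_approx q (\big[setU/set0]_(x <- s) (NL x).1).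
      by apply: ih => y ys; apply: sK; rewrite inE ys orbT.
    exact: (fibrewise_approxU a1 a2 e0).
  move=> /(_ (finmap.enum_fset D)) aD e e0.
  have [|C [B CB h]] := aD _ e e0; first by move=> x /DK; rewrite inE.
  exists C, B => // x /KD[y yD Ny]; apply: h.
  by rewrite -bigcup_seq; exists y.
move=> e e0; have e20 : 0 < e / 2 by rewrite divr_gt0.
have [K [cK KE hK]] := radon_tight fm rm mE e20.
have [C [B [cC CU mB hB] h]] := compactE K cK KE _ e20.
have mEK : measurable (E `\` K : set (borel X)).
  by apply: measurableD => //; exact: compact_borel.
exists C, (B `|` (E `\` K)).
  split=> //; first exact: measurableU.
  by rewrite [e]splitr EFinD; apply: le_trans (leeD hB hK); exact: measureU2.
move=> x Ex nB; apply: h; last by move=> ?; apply: nB; left.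
by apply: contrapT => nK; apply: nB; right.
Qed.

(** A uniform choice of [C] for finitely many equidistant levels; the next lemma
reads it as a uniform approximation of [fun x => n (xsection U x)]. *)
Lemma fibrewise_approx_levels (N : nat) (d e : R) : 0 < e ->
  exists C : set XY, exists2 B : set (borel X),
    [/\ compact C, C `<=` U, measurable B & (m B <= e%:E)%E] &
    forall x, ~ B x -> forall k, (k < N)%N ->
      ((k%:R * d)%:E < n (xsection U x))%E -> ((k%:R * d)%:E < n (xsection C x))%E.
Proof.
elim: N e => [|N ih] e e0.
  exists set0, set0 => //; split=> //; first exact: compact0.
  by rewrite measure0 lee_fin ltW.
have e20 : 0 < e / 2 by rewrite divr_gt0.
have [C1 [B1 [cC1 C1U mB1 hB1] h1]] := ih _ e20.
have [C2 [B2 [cC2 C2U mB2 hB2] h2]] := fibrewise_approx_level (N%:R * d) e20.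
have mC1 := compact_borel cC1; have mC2 := compact_borel cC2.
have mC := measurableU _ _ mC1 mC2.
exists (C1 `|` C2), (B1 `|` B2).
  split; [exact: compactU|by rewrite subUset|exact: measurableU|].
  rewrite [e]splitr EFinD; apply: le_trans (leeD hB1 hB2).
  exact: measureU2.
move=> x nB k; rewrite ltnS leq_eqVlt => /predU1P[->|kN] kU.
  apply: lt_le_trans (h2 x kU _) _; first by move=> ?; apply: nB; right.
  by apply: le_section => // z; right.
apply: lt_le_trans (h1 x _ k kN kU) _; first by move=> ?; apply: nB; left.
by apply: le_section => // z; left.
Qed.

End SectionRegularity.

Section RadonProduct.
Context (R : realType) (X Y : hausdorffType).
Variables (m : {measure set (borel X) -> \bar R}) (n : {measure set (borel Y) -> \bar R}).
Hypotheses (fm : (m setT < +oo)%E) (rm : radon m) (fn : (n setT < +oo)%E) (rn : radon n).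
Local Notation XY := (X * Y)%type.

Lemma section_measure_rectangle (A : set (borel X)) (B : set (borel Y)) :
  measurable A -> measurable B ->
  (\int[m]_x n (xsection (A `*` B) x))%E = (m A * n B)%E.
Proof.
move=> mA mB; rewrite (eq_integral (fun x => (\1_A x)%:E * n B))%E; last first.
  move=> x _; rewrite indicE; have [xA|xA] := boolP (x \in A).
    by rewrite in_xsectionX// mul1e.
  by rewrite mul0e notin_xsectionX// measure0.
rewrite ge0_integralZr ?integral_indic ?setIT//; exact: measurableT_comp.
Qed.

(** Take levels at distance [d], up to the total mass [M] of [n]. Off the exceptional
set the sections of [C] then lose at most [d], and on it at most [M], so the integral
of the defect is at most [d * m setT + M * e']. *)
Lemma open_section_measure (U : set XY) (e : R) : open U -> 0 < e ->
  exists2 C : set XY, compact C /\ C `<=` U &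
    (\int[m]_x n (xsection (U `\` C) x) <= e%:E)%E.
Proof.
move=> oU e0.
have fin (C : set (borel XY)) x : measurable C -> n (xsection C x) \is a fin_num.
  by move=> mC; apply: finite_measure_fin_num => //; exact: borel_xsection.
pose M := fine (n setT); pose mX := fine (m setT).
have nM : n setT = M%:E by rewrite fineK// finite_measure_fin_num.
have mM : m setT = mX%:E by rewrite fineK// finite_measure_fin_num.
have M0 : 0 <= M by exact: fine_ge0.
have mX0 : 0 <= mX by exact: fine_ge0.
pose d := e / 2 / (mX + 1); pose e' := e / 2 / (M + 1).
have d0 : 0 < d by rewrite !divr_gt0// ltr_wpDl.
have e'0 : 0 < e' by rewrite !divr_gt0// ltr_wpDl.
pose N := (Num.truncn (M / d)).+1.
have Nd : M < N%:R * d by rewrite -ltr_pdivrMr//; exact: truncnS_gt.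
have [C [B [cC CU mB hB] h]] := fibrewise_approx_levels fm rm rn oU N d e'0.
have mU := open_borel oU; have mC := compact_borel cC.
have mUC : measurable (U `\` C : set (borel XY)) by exact: measurableD.
exists C => //.
apply: (@le_trans _ _ (\int[m]_x (d%:E + M%:E * (\1_B x)%:E)))%E.
  apply: ge0_le_integral => //.
  - exact: borel_fun_section.
  - apply: emeasurable_funD => //; apply: measurable_funeM.
    exact/measurable_EFinP.
  - move=> x _.
    have [Bx|nBx] := pselect (B x).
      rewrite indicE mem_set//= mule1.
      apply: (@le_trans _ _ (n setT)).
        by rewrite le_measure ?inE//; exact: borel_xsection.
      by rewrite nM leeDr// lee_fin ltW.
    rewrite indicE memNset//= mule0 adde0.
    have mUx := borel_xsection x mU; have mCx := borel_xsection x mC.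
    rewrite xsectionD// measureD//; last by rewrite -ge0_fin_numE// fin.
    rewrite setIidr; last exact: le_xsection.
    have := h x nBx; have := fineK (fin _ x mC); have := fineK (fin _ x mU).
    set u := fine _; set c := fine _ => uE cE lev.
    have c0 : 0 <= c by exact: fine_ge0.
    have uM : u <= M.
      by rewrite -lee_fin -nM fineK ?fin// le_measure ?inE.
    suff : (u%:E - c%:E <= d%:E)%E by rewrite uE cE.
    rewrite -uE -cE in lev; rewrite -EFinB lee_fin leNgt; apply/negP => ucd.
    (* The first level above [c] is still below [u], contradicting the choice of [C]. *)
    have k1 : c < (Num.truncn (c / d)).+1%:R * d.
      by rewrite -ltr_pdivrMr//; exact: truncnS_gt.
    have k2 : (Num.truncn (c / d)).+1%:R * d <= c + d.
      rewrite -natr1 mulrDl mul1r lerD2r -ler_pdivlMr//.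
      by rewrite truncn_le divr_ge0// ltW.
    have := lev (Num.truncn (c / d)).+1; rewrite !lte_fin => lev'.
    have : ((Num.truncn (c / d)).+1 < N)%N.
      rewrite -(ltr_nat R) -(ltr_pM2r d0); lra.
    move=> /lev'; lra.
rewrite ge0_integralD//; last 3 first.
- by move=> x _; rewrite lee_fin ltW.
- by move=> x _; rewrite mule_ge0// lee_fin.
- by apply: measurable_funeM; exact/measurable_EFinP.
rewrite integral_cst// ge0_integralZl//; last first.
- exact/measurable_EFinP.
rewrite integral_indic// setIT mM.
rewrite [e]splitr EFinD; apply: leeD.
  rewrite -EFinM lee_fin /d mulrAC ler_pdivrMr ?ltr_wpDl//.
  by rewrite ler_wpM2l ?lerDl ?divr_ge0 ?ltW.
apply: (@le_trans _ _ (M%:E * e'%:E))%E; first by apply: lee_wpmul2l.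
rewrite -EFinM lee_fin mulrC /e' mulrAC ler_pdivrMr ?ltr_wpDl//.
by rewrite ler_wpM2l ?lerDl ?divr_ge0 ?ltW.
Qed.

Lemma radon_product_exists : exists rho, is_radon_product m n rho.
Proof.
have [rho rhoE] := section_measure fn rn m.
have frho : (rho setT < +oo)%E.
  rewrite rhoE -setXTT section_measure_rectangle//.
  by rewrite lte_mul_pinfty// ge0_fin_numE.
exists rho; split; last by move=> A B mA mB; rewrite rhoE section_measure_rectangle.
apply: tight_radon => //; apply: open_tight => // U e oU e0.
have [C [cC CU] h] := open_section_measure oU e0.
by exists C; split=> //; rewrite rhoE.
Qed.

End RadonProduct.

(** The form in which products of Jordan parts arise: set functions that agree with
finite Radon measures on the Borel sets. *)
Lemma radon_productP (R : realType) (X Y : hausdorffType)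
    (mu : set (borel X) -> \bar R) (nu : set (borel Y) -> \bar R)
    (m : {measure set (borel X) -> \bar R}) (n : {measure set (borel Y) -> \bar R}) :
  (forall A : set (borel X), measurable A -> m A = mu A) ->
  (forall A : set (borel Y), measurable A -> n A = nu A) ->
  (m setT < +oo)%E -> radon m -> (n setT < +oo)%E -> radon n ->
  is_radon_product mu nu (radon_product mu nu).
Proof.
move=> mE nE fm rm fn rn; rewrite /radon_product.
case: pselect => [h|[]]; first by case: (cid h).
have [rho [rrho rhoE]] := radon_product_exists fm rm fn rn.
by exists rho; split=> // A B mA mB; rewrite rhoE// mE// nE.
Qed.

(** * Uniqueness on measurable rectangles *)

Lemma open_setX (X Y : topologicalType) (V : set X) (W : set Y) :
  open V -> open W -> open (V `*` W).
Proof.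
move=> oV oW; rewrite openE => -[x y] [/= Vx Wy].
by exists (V, W) => //; split; exact: open_nbhs_nbhs.
Qed.

Section RectangleUniqueness.
Context (R : realType) (X Y : hausdorffType).
Local Notation XY := (X * Y)%type.
Local Notation tv := (@complex_variation R XY).
Implicit Types la : set (borel XY) -> R[i]^o.

Let rectangles : set (set (borel XY)) := [set C | exists A : set (borel X),
  exists2 B : set (borel Y), measurable A /\ measurable B & C = A `*` B].

Lemma borel_setX (A : set (borel X)) (B : set (borel Y)) :
  measurable A -> measurable B -> measurable (A `*` B : set (borel XY)).
Proof.
move=> mA mB; rewrite (_ : A `*` B = fst @^-1` A `&` snd @^-1` B)//.
apply: measurableI; apply: continuous_borel => //.
- by move=> ?; exact: cvg_fst.
- by move=> ?; exact: cvg_snd.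
Qed.

Lemma complex_measureD la (A B : set (borel XY)) : complex_measure la ->
  measurable A -> measurable B -> A `<=` B -> la B = la A + la (B `\` A).
Proof.
move=> cla mA mB AB; rewrite -[in LHS](setDUK AB) complex_measureU//.
  exact: measurableD.
by rewrite setDIK.
Qed.

(** Rectangles are closed under intersection, so the pi-lambda theorem applies to the
class of null sets of [la], which is a Dynkin class for signed measures too. *)
Lemma eq0_generated_rectangles la : complex_measure la ->
  (forall (A : set (borel X)) (B : set (borel Y)), measurable A -> measurable B ->
     la (A `*` B) = 0) ->
  forall C : set (borel XY), <<s rectangles >> C -> la C = 0.
Proof.
move=> cla la0 C sC.
suff: <<s rectangles >> `<=` [set A : set (borel XY) | measurable A /\ la A = 0].
  by move=> /(_ _ sC)[].
apply: lambda_system_subset; [|apply/dynkin_lambda_system; split| |by []].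
- move=> _ _ [A1 [B1 [mA1 mB1] ->]] [A2 [B2 [mA2 mB2] ->]].
  exists (A1 `&` A2), (B1 `&` B2); first by split; exact: measurableI.
  by rewrite setXI.
- by split=> //; rewrite -setXTT la0.
- move=> A [mA lA]; split; first exact: measurableC.
  have := complex_measureD cla mA measurableT (@subsetT _ A).
  by rewrite lA add0r setTD => <-; rewrite -setXTT la0.
- move=> F tF Fla; have mF k : measurable (F k : set (borel XY)) by have [] := Fla k.
  split; first exact: (bigcupT_measurable (F : nat -> set (borel XY))).
  have := cla.2 _ mF tF.
  rewrite (_ : (fun n => _) = fun=> 0).
    move=> h; apply: (cvg_unique (@norm_hausdorff _ R[i]^o) h); exact: cvg_cst.
  by apply/funext => n; rewrite big1// => k _; have [] := Fla k.
- by move=> _ [A [B [mA mB] ->]]; split; [exact: borel_setX|exact: la0].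
Qed.

(** A compact set is covered, inside an open set of nearly the same variation, by a
finite union of open rectangles; [la] vanishes on that union. *)
Lemma eq0_compact la (K : set XY) : complex_radon la ->
  (forall (A : set (borel X)) (B : set (borel Y)), measurable A -> measurable B ->
     la (A `*` B) = 0) ->
  compact K -> la K = 0.
Proof.
move=> rla la0 cK; have mK := compact_borel cK.
apply: mod_eq0; apply/eqP; rewrite eq_le mod_ge0 andbT.
apply/ler_addgt0Pr => e e0; rewrite add0r.
(* Outer regularity of [K]: its complement is almost exhausted by a compact [C]. *)
have [C [cC CK hC]] := complex_radon_tight rla (measurableC mK) e0.
have mC := compact_borel cC.
have oC : open (~` C : set XY).
  by apply: closed_openC; apply: compact_closed cC; exact: hausdorff.
have /choice[VW VWP] : forall p : XY, exists VW : set X * set Y, ~ C p ->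
    [/\ open VW.1, open VW.2, VW.1 p.1, VW.2 p.2 & VW.1 `*` VW.2 `<=` ~` C].
  move=> p; have [Cp|nCp] := pselect (C p); first by exists (set0, set0).
  have [[V W] [/= Vp Wp] VWC] : nbhs p (~` C) by apply: open_nbhs_nbhs.
  exists (V°, W°) => _ /=; split; [exact: open_interior|exact: open_interior| | |].
  - exact: nbhs_singleton (nbhs_interior Vp).
  - exact: nbhs_singleton (nbhs_interior Wp).
  - move=> [x y] [/= Vx Wy]; apply: (VWC (x, y)); split=> /=; exact: interior_subset.
have KC p : K p -> ~ C p by move=> Kp Cp; exact: (CK _ Cp Kp).
have := cK; rewrite compact_cover => /(_ XY K (fun p => (VW p).1 `*` (VW p).2)).
case=> [p /KC /VWP[oV oW _ _ _]|p Kp|D DK KD].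
- exact: open_setX.
- by exists p => //; have [_ _ ? ? _] := VWP p (KC p Kp).
pose W : set (borel XY) := \big[setU/set0]_(p <- finmap.enum_fset D) ((VW p).1 `*` (VW p).2).
have [sW mW WC] : [/\ <<s rectangles >> W, measurable W & W `<=` ~` C].
  have : {in finmap.enum_fset D, forall p, K p} by move=> p /DK; rewrite inE.
  rewrite /W; elim: (finmap.enum_fset D) => [_|p s ih sK].
    rewrite big_nil; split=> //; exact: (@sigma_algebra0 _ setT).
  have [|sW mW WC] := ih; first by move=> q qs; apply: sK; rewrite inE qs orbT.
  have [oV oW _ _ VWC] := VWP p (KC p (sK p (mem_head _ _))).
  have mV := open_borel oV; have mW' := open_borel oW.
  rewrite big_cons; split.
  - apply: (@measurableU _ (g_sigma_algebraType rectangles)) => //.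
    apply: sub_sigma_algebra.
    by exists (VW p).1, (VW p).2.
  - apply: measurableU => //; exact: borel_setX.
  - by rewrite subUset.
have KW : K `<=` W by move=> p /KD[q qD hq]; rewrite /W -bigcup_seq; exists q.
have := complex_measureD rla.1 mK mW KW.
rewrite (eq0_generated_rectangles rla.1 la0 sW) => /eqP.
rewrite eq_sym addr_eq0 => /eqP ->; rewrite normrN.
have mWK : measurable (W `\` K) by exact: measurableD.
rewrite -lee_fin; apply: le_trans (mod_le_tv la mWK) _; apply: le_trans hC.
apply: tv_mono => //; first by apply: measurableD => //; exact: measurableC.
by move=> x [/WC nC nK]; split.
Qed.

(** Although the rectangles need not generate the Borel sets of the product, a complex
Radon measure is determined by its values on them, because it is determined by its
values on compact sets. *)
Lemma complex_radon_eq0 la : complex_radon la ->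
  (forall (A : set (borel X)) (B : set (borel Y)), measurable A -> measurable B ->
     la (A `*` B) = 0) ->
  la = 0.
Proof.
move=> rla la0; apply/funext => A; rewrite [RHS]/=.
have [mA|nmA] := pselect (measurable A); last by rewrite rla.1.1.
apply: mod_eq0; apply/eqP; rewrite eq_le mod_ge0 andbT.
apply/ler_addgt0Pr => e e0; rewrite add0r.
have [K [cK KA h]] := complex_radon_tight rla mA e0.
have mK := compact_borel cK.
rewrite (complex_measureD rla.1 mK mA KA) (eq0_compact rla la0 cK) add0r.
rewrite -lee_fin; apply: le_trans h; apply: mod_le_tv; exact: measurableD.
Qed.

End RectangleUniqueness.

(** * The product of complex Radon measures *)

Section ComplexProduct.
Context (R : realType) (X Y : hausdorffType).
Local Notation XY := (X * Y)%type.
Implicit Types (mu : set (borel X) -> R[i]^o) (nu : set (borel Y) -> R[i]^o).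

Definition jordan_product mu nu j k : {measure set (borel XY) -> \bar R} :=
  radon_product (jordan_part j mu) (jordan_part k nu).

(** The same sum over the Jordan parts as [complex_radon_product], assembled as a
linear combination of complex measures so that it can be estimated term by term. *)
Definition complex_product mu nu : set (borel XY) -> R[i]^o :=
  \sum_(j < 4) \sum_(k < 4)
    ('i%C ^+ (j + k) : R[i]) *: (complex_of_measure (jordan_product mu nu j k)).

Lemma complex_productE mu nu (C : set (borel XY)) : measurable C ->
  complex_product mu nu C = complex_radon_product mu nu C.
Proof.
move=> mC; rewrite /complex_product /complex_radon_product fct_sumE.
apply: eq_bigr => j _; rewrite fct_sumE; apply: eq_bigr => k _.
by rewrite /complex_of_measure /jordan_product [LHS]/GRing.scale/= asboolT.
Qed.

Section Properties.
Variables (mu : set (borel X) -> R[i]^o) (nu : set (borel Y) -> R[i]^o).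
Hypotheses (rmu : complex_radon mu) (rnu : complex_radon nu).

Lemma jordan_productP j k : is_radon_product (jordan_part j mu) (jordan_part k nu)
  (jordan_product mu nu j k).
Proof.
have [m [mE rm fm _]] := jordan_part_measure j rmu.
have [n [nE rn fn _]] := jordan_part_measure k rnu.
exact: (radon_productP mE nE).
Qed.

Lemma jordan_product_le j k (A : set (borel X)) (B : set (borel Y)) :
  measurable A -> measurable B ->
  (jordan_product mu nu j k (A `*` B) <=
   complex_variation mu A * complex_variation nu B)%E.
Proof.
move=> mA mB; rewrite (jordan_productP j k).2//.
have [m [mE _ _ mle]] := jordan_part_measure j rmu.
have [n [nE _ _ nle]] := jordan_part_measure k rnu.
by rewrite -mE// -nE//; apply: lee_pmul => //; [exact: mle|exact: nle].
Qed.

Lemma jordan_product_finite j k : (jordan_product mu nu j k setT < +oo)%E.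
Proof.
rewrite -setXTT; apply: le_lt_trans (jordan_product_le j k measurableT measurableT) _.
by rewrite ltey_eq fin_numM// tv_fin.
Qed.

Lemma complex_radon_product_term j k :
  complex_radon (complex_of_measure (jordan_product mu nu j k)).
Proof.
apply: complex_radon_of_measure; first exact: jordan_product_finite.
exact: (jordan_productP j k).1.
Qed.

Lemma complex_radon_complex_product : complex_radon (complex_product mu nu).
Proof.
apply: complex_radon_sum => j; apply: complex_radon_sum => k.
by apply: complex_radonZ; exact: complex_radon_product_term.
Qed.

Lemma complex_product_rectangle (A : set (borel X)) (B : set (borel Y)) :
  measurable A -> measurable B ->
  complex_product mu nu (A `*` B) = mu A * nu B.
Proof.
move=> mA mB; rewrite (jordan_decomposition rmu mA) (jordan_decomposition rnu mB).
rewrite /complex_product fct_sumE mulr_suml.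
apply: eq_bigr => j _; rewrite fct_sumE mulr_sumr; apply: eq_bigr => k _.
rewrite [LHS]/GRing.scale/= /complex_of_measure asboolT; last exact: borel_setX.
rewrite (jordan_productP j k).2//.
have fj i (la : set (borel X) -> R[i]^o) :
    complex_radon la -> jordan_part i la A \is a fin_num.
  by move=> rla; rewrite jordan_partE positive_part_fin//; exact: complex_radonZ.
have fk i (la : set (borel Y) -> R[i]^o) :
    complex_radon la -> jordan_part i la B \is a fin_num.
  by move=> rla; rewrite jordan_partE positive_part_fin//; exact: complex_radonZ.
rewrite fineM ?fj ?fk// rmorphM/= exprD.
by rewrite [LHS]mulrACA.
Qed.

Lemma tv_complex_product (C : set (borel XY)) : measurable C ->
  (complex_variation (complex_product mu nu) C <=
   \sum_(j < 4) \sum_(k < 4) jordan_product mu nu j k C)%E.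
Proof.
move=> mC; apply: le_trans (tv_sum _ mC) _; apply: lee_sum => j _.
apply: le_trans (tv_sum _ mC) _; apply: lee_sum => k _.
rewrite tvZ// (_ : complex.Re _ = 1) ?mul1e.
  by apply: tv_complex_of_measure => //; exact: jordan_product_finite.
have := complex_mod_i R (j + k); by rewrite exprNn normrM normrX normrN1 expr1n mul1r.
Qed.

(** Each of the 16 products of Jordan parts is at most the product of the variations.
The sharp constant is 1; a fixed constant is enough for continuity. *)
Lemma tv_complex_product_rectangle (A : set (borel X)) (B : set (borel Y)) :
  measurable A -> measurable B ->
  (complex_variation (complex_product mu nu) (A `*` B) <=
   16%:E * (complex_variation mu A * complex_variation nu B))%E.
Proof.
move=> mA mB; apply: le_trans (tv_complex_product (borel_setX mA mB)) _.
have : (complex_variation mu A * complex_variation nu B)%E \is a fin_num.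
  by rewrite fin_numM// tv_fin.
move=> /fineK; set c := fine _ => cE.
have le j k : (jordan_product mu nu j k (A `*` B) <= c%:E)%E.
  by rewrite cE; exact: jordan_product_le.
rewrite -cE; apply: (@le_trans _ _ (\sum_(j < 4) \sum_(k < 4) c%:E)%E).
  by apply: lee_sum => j _; apply: lee_sum => k _.
rewrite !big_ord_recr !big_ord0/= -!EFinD -EFinM lee_fin; lra.
Qed.

(** The complement of [K `*` L] is covered by two rectangles with a null side. *)
Lemma complex_product_null (K : set X) (L : set Y) : closed K -> closed L ->
  complex_variation mu (~` K) = 0%E -> complex_variation nu (~` L) = 0%E ->
  complex_variation (complex_product mu nu) (~` (K `*` L)) = 0%E.
Proof.
move=> cK cL muK nuL.
have mK := measurableC (closed_borel cK); have mL := measurableC (closed_borel cL).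
have [m [mE _ _]] := (complex_radon_complex_product).2.
have mKL : measurable (K `*` L : set (borel XY)).
  by apply: borel_setX; exact: closed_borel.
apply/eqP; rewrite eq_le tv_ge0 ?andbT; last exact: measurableC.
have mKT : measurable ((~` K) `*` setT : set (borel XY)) by exact: borel_setX.
have mTL : measurable (setT `*` (~` L) : set (borel XY)) by exact: borel_setX.
rewrite -mE; last exact: measurableC.
apply: (@le_trans _ _ (m ((~` K) `*` setT) + m (setT `*` (~` L)))%E).
  apply: le_trans (measureU2 _ mKT mTL); apply: le_measure; rewrite ?inE.
  - exact: measurableC.
  - exact: measurableU.
  - move=> [x y] /= nKL; have [Kx|nKx] := pselect (K x); last by left.
    by right; split=> //= Ly; apply: nKL.
rewrite !mE// -[leRHS]adde0; apply: leeD.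
  apply: le_trans (tv_complex_product_rectangle mK measurableT) _.
  by rewrite muK mul0e mule0.
apply: le_trans (tv_complex_product_rectangle measurableT mL) _.
by rewrite nuL !mule0.
Qed.

End Properties.

(** The Jordan parts do not depend linearly on the measure; bilinearity of the product
comes from this characterization by rectangles instead. *)
Lemma complex_product_unique (la : set (borel XY) -> R[i]^o) mu nu :
  complex_radon mu -> complex_radon nu -> complex_radon la ->
  (forall (A : set (borel X)) (B : set (borel Y)), measurable A -> measurable B ->
     la (A `*` B) = mu A * nu B) ->
  la = complex_product mu nu.
Proof.
move=> rmu rnu rla laE; apply/eqP; rewrite -subr_eq0; apply/eqP.
apply: complex_radon_eq0 => [|A B mA mB].
  rewrite -[X in (_ - X)%R]scale1r -scaleNr addrC; apply: complex_radon_lin => //.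
  exact: complex_radon_complex_product.
have -> : (la - complex_product mu nu) (A `*` B) =
          la (A `*` B) - complex_product mu nu (A `*` B) by [].
by rewrite laE// complex_product_rectangle// subrr.
Qed.

Lemma complex_product_linl (a : R[i]) mu mu' nu :
  complex_radon mu -> complex_radon mu' -> complex_radon nu ->
  complex_product (a *: mu + mu') nu =
    a *: complex_product mu nu + complex_product mu' nu.
Proof.
move=> rmu rmu' rnu; apply/esym/complex_product_unique => //.
- exact: complex_radon_lin.
- by apply: complex_radon_lin; exact: complex_radon_complex_product.
move=> A B mA mB.
have -> : (a *: complex_product mu nu + complex_product mu' nu) (A `*` B) =
  a * complex_product mu nu (A `*` B) + complex_product mu' nu (A `*` B) by [].
have -> : (a *: mu + mu') A = a * mu A + mu' A by [].
by rewrite !complex_product_rectangle// mulrDl mulrA.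
Qed.

Lemma complex_product_linr (a : R[i]) mu nu nu' :
  complex_radon mu -> complex_radon nu -> complex_radon nu' ->
  complex_product mu (a *: nu + nu') =
    a *: complex_product mu nu + complex_product mu nu'.
Proof.
move=> rmu rnu rnu'; apply/esym/complex_product_unique => //.
- exact: complex_radon_lin.
- by apply: complex_radon_lin; exact: complex_radon_complex_product.
move=> A B mA mB.
have -> : (a *: complex_product mu nu + complex_product mu nu') (A `*` B) =
  a * complex_product mu nu (A `*` B) + complex_product mu nu' (A `*` B) by [].
have -> : (a *: nu + nu') B = a * nu B + nu' B by [].
by rewrite !complex_product_rectangle// mulrDr mulrCA.
Qed.

End ComplexProduct.

(** * Convolution of compactly supported measures *)

Section Convolution.
Context (R : realType) (G : hausdorffTopGroupType).
Implicit Types (mu nu : radonMc R G) (K L : set G).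

Let mul (p : G * G) : G := (p.1 * p.2)%g.

Let mul_continuous : continuous mul.
Proof. exact: mulg_continuous. Qed.

Definition mul_set K L : set G := mul @` (K `*` L).

Lemma compact_mul_set K L : compact K -> compact L -> compact (mul_set K L).
Proof.
move=> cK cL; apply: continuous_compact; last exact: compact_setX.
exact/continuous_subspaceT.
Qed.

Lemma convolution_fun_pushforward (mu nu : set (borel G) -> R[i]^o) :
  convolution_fun mu nu = complex_pushforward mul (complex_product mu nu).
Proof.
apply/funext => A; rewrite /convolution_fun /complex_pushforward.
have [mA|nmA] := pselect (measurable A); last by rewrite !asboolF.
rewrite !asboolT// complex_productE//; exact: continuous_borel.
Qed.

Lemma tv_off_supp (mu : set (borel G) -> R[i]^o) K : complex_radon mu -> closed K ->
  supp mu `<=` K -> complex_variation mu (~` K) = 0%E.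
Proof.
move=> rmu cK sK; have mK := measurableC (closed_borel cK).
apply/eqP; rewrite eq_le tv_ge0// andbT -(tv_supp rmu).
apply: tv_mono => //; last exact: subsetC.
by apply: measurableC; apply: closed_borel; exact: closed_supp.
Qed.

Lemma complex_radon_convolution_fun (mu nu : set (borel G) -> R[i]^o) :
  complex_radon mu -> complex_radon nu -> complex_radon (convolution_fun mu nu).
Proof.
move=> rmu rnu; rewrite convolution_fun_pushforward.
by apply: complex_radon_pushforward => //; exact: complex_radon_complex_product.
Qed.

Lemma supp_convolution_fun (mu nu : set (borel G) -> R[i]^o) K L :
  complex_radon mu -> complex_radon nu -> compact K -> compact L ->
  supp mu `<=` K -> supp nu `<=` L -> supp (convolution_fun mu nu) `<=` mul_set K L.
Proof.
move=> rmu rnu cK cL sK sL.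
have clK : closed K by apply: compact_closed cK; exact: hausdorff.
have clL : closed L by apply: compact_closed cL; exact: hausdorff.
have cKL := compact_mul_set cK cL.
have clKL : closed (mul_set K L) by apply: compact_closed cKL; exact: hausdorff.
apply: bigcap_inf; split=> //.
have mKL := measurableC (closed_borel clKL).
apply/eqP; rewrite eq_le tv_ge0// andbT convolution_fun_pushforward.
apply: le_trans (tv_pushforward mul_continuous _ mKL) _.
have := complex_product_null rmu rnu clK clL (tv_off_supp rmu clK sK) (tv_off_supp rnu clL sL).
move=> <-; apply: tv_mono.
- exact: complex_radon_complex_product.
- exact: continuous_borel.
- by apply: measurableC; apply: compact_borel; exact: compact_setX.
- by move=> p /= nKL KLp; apply: nKL; exists p.
Qed.

Lemma radonMc_compact mu : exists2 K : set G, compact K & supp mu `<=` K.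
Proof. by have /asboolP[K cK /asboolP sK] := radonMc_subproof mu; exists K. Qed.

(** The total operation [convolution] never falls back on its default value. *)
Lemma convolutionE mu nu :
  (convolution mu nu : set (borel G) -> R[i]^o) = convolution_fun mu nu.
Proof.
have r := complex_radon_convolution_fun (radonMP mu) (radonMP nu).
have [K cK sK] := radonMc_compact mu; have [L cL sL] := radonMc_compact nu.
have e : (insubd (0 : radonM R G) (convolution_fun mu nu) : set (borel G) -> R[i]^o) =
    convolution_fun mu nu.
  by rewrite [LHS]insubdK//; apply/asboolP.
rewrite -[RHS]e; congr (radonM_fun _); rewrite [LHS]insubdK//.
apply/asboolP; exists (mul_set K L); first exact: compact_mul_set.
apply/asboolP; rewrite e; apply: supp_convolution_fun => //; exact: radonMP.
Qed.

Lemma supp_convolution mu nu K L : compact K -> compact L ->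
  supp mu `<=` K -> supp nu `<=` L -> supp (convolution mu nu) `<=` mul_set K L.
Proof. by rewrite convolutionE; apply: supp_convolution_fun; exact: radonMP. Qed.

Lemma radonMc_ext mu nu : (mu : set (borel G) -> R[i]^o) = nu -> mu = nu.
Proof. by move=> e; apply: val_inj; apply: val_inj. Qed.

Lemma radonMc_linE (a : R[i]) mu nu :
  (a *: mu + nu : radonMc R G) = a *: (mu : set (borel G) -> R[i]^o) + nu
    :> (set (borel G) -> R[i]^o).
Proof. by []. Qed.

Lemma complex_pushforward_lin (a : R[i]) (f : G * G -> G)
    (la la' : set (borel (G * G)%type) -> R[i]^o) :
  complex_pushforward f (a *: la + la') =
    a *: complex_pushforward f la + complex_pushforward f la'.
Proof.
apply/funext => A; rewrite [RHS]/GRing.add/= [in RHS]/GRing.scale/= /complex_pushforward.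
by case: ifP => // _; rewrite scaler0 addr0.
Qed.

Lemma convolution_linl (a : R[i]) mu mu' nu :
  convolution (a *: mu + mu') nu = a *: convolution mu nu + convolution mu' nu.
Proof.
apply: radonMc_ext; apply: (etrans (convolutionE _ _)).
apply: (etrans _ (f_equal2 (fun f g : set (borel G) -> R[i]^o => a *: f + g)
  (esym (convolutionE mu nu)) (esym (convolutionE mu' nu)))).
rewrite (convolution_fun_pushforward mu nu) (convolution_fun_pushforward mu' nu).
rewrite -complex_pushforward_lin convolution_fun_pushforward.
apply: (f_equal (complex_pushforward _)).
rewrite radonMc_linE.
exact: (complex_product_linl a (radonMP mu) (radonMP mu') (radonMP nu)).
Qed.

Lemma convolution_linr (a : R[i]) mu nu nu' :
  convolution mu (a *: nu + nu') = a *: convolution mu nu + convolution mu nu'.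
Proof.
apply: radonMc_ext; apply: (etrans (convolutionE _ _)).
apply: (etrans _ (f_equal2 (fun f g : set (borel G) -> R[i]^o => a *: f + g)
  (esym (convolutionE mu nu)) (esym (convolutionE mu nu')))).
rewrite (convolution_fun_pushforward mu nu) (convolution_fun_pushforward mu nu').
rewrite -complex_pushforward_lin convolution_fun_pushforward.
apply: (f_equal (complex_pushforward _)).
rewrite radonMc_linE.
exact: (complex_product_linr a (radonMP mu) (radonMP nu) (radonMP nu')).
Qed.

Lemma convolution_norm mu nu :
  radonM_norm (convolution mu nu) <= 16 * (radonM_norm mu * radonM_norm nu).
Proof.
have rmu := radonMP mu; have rnu := radonMP nu.
rewrite /radonM_norm convolutionE.
rewrite -lee_fin EFinM EFinM !fineK ?tv_fin//; last exact: complex_radon_convolution_fun.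
rewrite convolution_fun_pushforward.
apply: le_trans (tv_pushforward mul_continuous _ measurableT) _.
by rewrite preimage_setT -setXTT tv_complex_product_rectangle.
Qed.

End Convolution.

(** * Neighbourhoods of zero in the direct limit topology *)

Section DiskTopology.
Context (R : realType) (X : hausdorffType).
Local Notation Mc := (radonMc R X).
Local Notation C := R[i].

Lemma radonMc_inclP (x : Mc) :
  exists (K : set X) (cK : compact K) (z : radonM_in R K), x = radonMc_incl cK z.
Proof.
have /asboolP[K cK sK] := radonMc_subproof x.
by exists K, cK, (RadonMIn sK); apply: val_inj.
Qed.

Lemma radonMc_incl_lin (K : set X) (cK : compact K) (a : C) (y z : radonM_in R K) :
  radonMc_incl cK (a *: y + z) = a *: radonMc_incl cK y + radonMc_incl cK z.
Proof. by do 2!apply: val_inj. Qed.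

Lemma radonMc_incl0 (K : set X) (cK : compact K) :
  radonMc_incl cK (0 : radonM_in R K) = 0.
Proof. by do 2!apply: val_inj. Qed.

Lemma radonMc_inclZ (K : set X) (cK : compact K) (a : C) (y : radonM_in R K) :
  radonMc_incl cK (a *: y) = a *: radonMc_incl cK y.
Proof. by rewrite -[a *: y]addr0 radonMc_incl_lin radonMc_incl0 addr0. Qed.

Lemma radonMc_inclB (K : set X) (cK : compact K) (y z : radonM_in R K) :
  radonMc_incl cK (y - z) = radonMc_incl cK y - radonMc_incl cK z.
Proof. by rewrite addrC -scaleN1r radonMc_incl_lin scaleN1r addrC. Qed.

Definition convex_subset (V : set Mc) := forall (t : C) (x y : Mc),
  0 <= t -> t <= 1 -> V x -> V y -> V (t *: x + (1 - t) *: y).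

Definition balanced_subset (V : set Mc) := forall (a : C) (x : Mc),
  `|a| <= 1 -> V x -> V (a *: x).

(** The trace on each space M_K contains a ball. *)
Definition ball_absorbing (V : set Mc) := forall (K : set X) (cK : compact K),
  exists2 e : C, 0 < e & forall z : radonM_in R K, `|z| < e -> V (radonMc_incl cK z).

Lemma pos_lower_bound (a b : C) : 0 < a -> 0 < b -> exists c : C, [/\ 0 < c, c <= a & c <= b].
Proof.
move=> a0 b0; have /orP[ab|ba] := real_leVge (gtr0_real a0) (gtr0_real b0).
  by exists a.
by exists b.
Qed.

Section Disk.
Variable V : set Mc.
Hypotheses (cV : convex_subset V) (bV : balanced_subset V) (aV : ball_absorbing V).

Let V0 : V 0.
Proof.
have [e e0 h] := aV (@compact0 X).
by rewrite -(radonMc_incl0 (@compact0 X)); apply: h; rewrite normr0.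
Qed.

Let absorbing (x : Mc) : exists2 r : C, 0 < r & V (r *: x).
Proof.
have [K [cK [z ->]]] := radonMc_inclP x; have [e e0 h] := aV cK.
have n0 : 0 < `|z| + 1 by rewrite ltr_wpDl.
exists (e / (`|z| + 1)); first by rewrite divr_gt0.
rewrite -radonMc_inclZ; apply: h; rewrite normrZ gtr0_norm ?divr_gt0//.
by rewrite mulrAC ltr_pdivrMr// ltr_pM2l// ltrDl.
Qed.

Let V_half (v w : Mc) : V v -> V w -> V (2^-1 *: v + 2^-1 *: w).
Proof.
move=> Vv Vw; have -> : 2^-1 = 1 - 2^-1 :> C by field.
rewrite {1}(_ : 1 - 2^-1 = 2^-1); last by field.
by apply: cV => //; rewrite ?invr_ge0// invf_le1// ler1n.
Qed.

(** The translates of the multiples of [V] as neighbourhood bases: the topology of the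
gauge of [V], without the gauge. *)
Definition disk_nbhs (x : Mc) : set_system Mc :=
  [set A | exists2 e : C, 0 < e & forall v, V v -> A (x + e *: v)].

Let disk_nbhs_le (x : Mc) (A : set Mc) (e d : C) : 0 < d -> d <= e ->
  (forall v, V v -> A (x + e *: v)) -> forall v, V v -> A (x + d *: v).
Proof.
move=> d0 de h v Vv; have e0 := lt_le_trans d0 de.
have -> : d *: v = e *: ((d / e) *: v) by rewrite scalerA mulrC divfK ?gt_eqF.
apply: h; apply: bV => //.
by rewrite gtr0_norm ?divr_gt0// ler_pdivrMr// mul1r.
Qed.

Definition disk_space : Type := Mc.
HB.instance Definition _ := Choice.on disk_space.
HB.instance Definition _ := hasNbhs.Build disk_space disk_nbhs.

Let disk_nbhs_filter (x : disk_space) : ProperFilter (nbhs x).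
Proof.
apply: Build_ProperFilter_ex.
  by move=> A [e e0 h]; exists (x + e *: 0 : Mc); exact: h.
split.
- by exists 1.
- move=> A B [e e0 hA] [d d0 hB]; have [c [c0 ce cd]] := pos_lower_bound e0 d0.
  exists c => // v Vv; split; first exact: disk_nbhs_le hA _ Vv.
  exact: disk_nbhs_le hB _ Vv.
- by move=> A B AB [e e0 h]; exists e => // v /h /AB.
Qed.

Let disk_nbhs_singleton (x : disk_space) (A : set disk_space) : nbhs x A -> A x.
Proof.
move=> [e e0 h]; have := h 0 V0; rewrite scaler0.
by have -> : (x : Mc) + 0 = x by exact: addr0.
Qed.

Let disk_nbhs_nbhs (x : disk_space) (A : set disk_space) :
  nbhs x A -> nbhs x (nbhs^~ A).
Proof.
move=> [e e0 h]; have e20 : 0 < e / 2 by rewrite divr_gt0.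
exists (e / 2) => // v Vv; exists (e / 2) => // w Vw.
have -> : (x : Mc) + (e / 2) *: v + (e / 2) *: w = (x : Mc) + e *: (2^-1 *: v + 2^-1 *: w).
  by rewrite scalerDr !scalerA addrA.
exact: h (V_half Vv Vw).
Qed.

HB.instance Definition _ := Nbhs_isNbhsTopological.Build disk_space
  disk_nbhs_filter disk_nbhs_singleton disk_nbhs_nbhs.

Let T : Topological Mc := Topological.class disk_space.

(** Continuity of scalar multiplication uses that [V] absorbs points, which follows
from absorbing balls since every element lies in some M_K. The interiors of the sets
[x + e V] form a base of convex open sets. *)
Lemma lc_compatible_disk : lc_compatible T.
Proof.
split.
- move=> [x y] A [e e0 h]; have e20 : 0 < e / 2 by rewrite divr_gt0.
  exists ([set z | exists2 v, V v & z = x + (e/2) *: v],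
          [set z | exists2 v, V v & z = y + (e/2) *: v]); first split.
  + by exists (e / 2) => // v Vv; exists v.
  + by exists (e / 2) => // v Vv; exists v.
  + move=> [_ _] [/= [v Vv ->] [w Vw ->]].
    rewrite addrACA.
    have -> : (e / 2) *: v + (e / 2) *: w = e *: (2^-1 *: v + 2^-1 *: w).
      by rewrite scalerDr !scalerA.
    exact: h (V_half Vv Vw).
- move=> [a x] A [e e0 h]; have e20 : 0 < e / 2 by rewrite divr_gt0.
  have [r r0 Vr] := absorbing x.
  (* [d] bounds the change of the scalar and [s] that of the vector, such that each
     of the two resulting errors lies in half of [e V]. *)
  pose d := r * (e / 2); have d0 : 0 < d by rewrite mulr_gt0.
  have n0 : 0 < `|a| + d by rewrite ltr_wpDl.
  pose s := (e / 2) / (`|a| + d); have s0 : 0 < s by rewrite divr_gt0.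
  exists ([set b : C | `|a - b| < d], [set z | exists2 v, V v & z = x + s *: v]).
    split=> /=; first by apply/(@nbhs_normP _ C^o); exists d.
    by exists s => // v Vv; exists v.
  move=> [b _] [/= ab [v Vv ->]].
  have bd : `|b| <= `|a| + d.
    rewrite -[b](subrK a) addrC (le_trans (ler_normD _ _))// lerD2l.
    by rewrite distrC ltW.
  have -> : b *: (x + s *: v) = a *: x +
      e *: (2^-1 *: (((b - a) / d) *: (r *: x)) + 2^-1 *: ((b / (`|a| + d)) *: v)).
    rewrite !scalerDr !scalerA.
    have -> : e / 2 * ((b - a) / d) * r = b - a.
      by rewrite /d; field; rewrite !gt_eqF.
    have -> : e / 2 * (b / (`|a| + d)) = b * s.
      by rewrite /s; field; rewrite gt_eqF.
    by rewrite addrA -scalerDl [a + _]addrC subrK.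
  apply: h; apply: V_half; apply: bV => //.
  + rewrite normrM normfV (gtr0_norm d0) ler_pdivrMr// mul1r distrC ltW//.
  + by rewrite normrM normfV (gtr0_norm n0) ler_pdivrMr// mul1r.
- exists [set U : set disk_space | open U /\ convex_set (U : set Mc)] => [b []//|].
  split=> [b []//|x A [e e0 h]].
  pose S : set disk_space := [set z | exists2 v, V v & z = (x : Mc) + e *: v].
  exists [set y : disk_space | nbhs y S]; last first.
    by move=> y /disk_nbhs_singleton [v Vv ->]; exact: h.
  split; last by exists e => // v Vv; exists v.
  split; first by move=> y; exact: disk_nbhs_nbhs.
  move=> y z l; rewrite !inE => -[d1 d10 h1] [d2 d20 h2].
  have [d [d0 dd1 dd2]] := pos_lower_bound d10 d20.
  exists d => // v Vv.
  have [v1 Vv1 e1] := disk_nbhs_le d0 dd1 h1 Vv.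
  have [v2 Vv2 e2] := disk_nbhs_le d0 dd2 h2 Vv.
  exists (l%:num *: v1 + (1 - l%:num) *: v2).
    exact: cV.
  have comb (k : C) (p q w : Mc) :
      k *: p + (1 - k) *: q + w = k *: (p + w) + (1 - k) *: (q + w).
    by rewrite !scalerDr addrACA -scalerDl [k + _]addrC subrK scale1r.
  apply: (etrans (comb l%:num y z (d *: v))).
  rewrite (e1 : (y : Mc) + d *: v = _) (e2 : (z : Mc) + d *: v = _).
  rewrite ![(x : Mc) + _]addrC -comb.
  by rewrite scalerDr !scalerA ![e * _]mulrC.
- move=> K cK mu A [e e0 h]; have [d d0 hd] := aV cK.
  apply/(@nbhs_normP _ (radonM_in R K)); exists (e * d); first by rewrite /= mulr_gt0.
  move=> z /= zmu; rewrite /preimage /=.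
  have -> : radonMc_incl cK z = radonMc_incl cK mu + e *: radonMc_incl cK (e^-1 *: (z - mu)).
    by rewrite -radonMc_inclZ scalerA mulfV ?gt_eqF// scale1r radonMc_inclB addrC subrK.
  apply: h; apply: hd; rewrite normrZ normfV (gtr0_norm e0).
  by rewrite mulrC ltr_pdivrMr// mulrC distrC.
Qed.

(** The direct limit topology is finer than every compatible topology, in particular
than the one in which [V] is a neighbourhood of 0 by construction. *)
Lemma disk_nbhs0 : nbhs (0 : Mc) V.
Proof.
apply: (lc_nbhs lc_compatible_disk); exists 1 => // v Vv.
by rewrite add0r scale1r.
Qed.

End Disk.

End DiskTopology.

(** * Continuity of convolution is decided at the origin *)

Section VectorTopology.
Context (R : realType) (X : hausdorffType).
Local Notation Mc := (radonMc R X).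
Local Notation C := R[i].

Lemma radonMc_add_nbhs (x y : Mc) (A : set Mc) : nbhs (x + y) A ->
  exists2 V : set Mc, nbhs x V & exists2 W : set Mc, nbhs y W &
    forall v w, V v -> W w -> A (v + w).
Proof.
have [addc _ _ _] := lc_compatible_radonMc R X.
move=> /(addc (x, y)) [[V W] [/= Vx Wy] VW]; exists V => //; exists W => // v w Vv Ww.
exact: (VW (v, w)).
Qed.

Lemma radonMc_translate_nbhs (x y : Mc) (A : set Mc) : nbhs (x + y) A ->
  nbhs x [set v | A (v + y)].
Proof.
move=> /radonMc_add_nbhs[V Vx [W Wy VW]]; apply: filterS Vx => v Vv.
by apply: VW => //; exact: nbhs_singleton Wy.
Qed.

Lemma radonMc_scale_nbhs0 (a : C) (V : set Mc) : nbhs 0 V -> nbhs 0 [set x | V (a *: x)].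
Proof.
have [_ scalec _ _] := lc_compatible_radonMc R X.
move=> V0; have : nbhs (a *: (0 : Mc)) V by rewrite scaler0.
move=> /(scalec (a : C^o, 0 : Mc)) [[S W] [/= Sa W0] SW].
apply: filterS W0 => w Ww; apply: (SW (a, w)); split=> //=.
exact: nbhs_singleton Sa.
Qed.

Lemma radonMc_absorbing (x : Mc) (V : set Mc) : nbhs 0 V ->
  exists2 e : R, 0 < e & forall a : R, 0 < a -> a < e -> V (a%:C%C *: x).
Proof.
have [_ scalec _ _] := lc_compatible_radonMc R X.
move=> V0; have : nbhs ((0 : C) *: x) V by rewrite scale0r.
move=> /(scalec (0 : C^o, x)) [[S W] [/= S0 Wx] SW].
have /(@nbhs_normP _ C^o)[[e e'] /= e0 eS] := S0.
move: e0; rewrite ltcE/= => /andP[/eqP e'0 e0]; exists e => // a a0 ae.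
apply: (SW (a%:C%C, x)); split=> /=; last exact: nbhs_singleton Wx.
apply: eS; rewrite /= sub0r normrN normc_def/= expr0n addr0 sqrtr_sqr gtr0_norm//.
by rewrite e'0 ltcE/= eqxx ae.
Qed.

(** A convex neighbourhood [b] of 0 contains the balanced set of all [x] with [a *: x]
in [b] whenever [`|a| <= 1]; balls are balanced, so this set still absorbs them. *)
Lemma radonMc_convex_nbhs (U : set Mc) : nbhs 0 U ->
  exists2 V : set Mc, V `<=` U &
    [/\ convex_subset V, balanced_subset V & ball_absorbing V].
Proof.
have [_ _ [B cB [Bo Bx]] iK] := lc_compatible_radonMc R X.
move=> /(Bx 0)[b [Bb b0] bU].
have nb : nbhs (0 : Mc) b by apply: open_nbhs_nbhs; split=> //; exact: Bo.
exists [set x | forall a : C, `|a| <= 1 -> b (a *: x)].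
  by move=> x /(_ 1); rewrite normr1 scale1r => /(_ (lexx _)) /bU.
split.
- move=> t x y t0 t1 bx by_ a a1.
  have := cB _ Bb (a *: x) (a *: y) (Itv01 t0 t1).
  rewrite !inE => /(_ (bx a a1) (by_ a a1)).
  by rewrite scalerDr !scalerA ![a * _]mulrC -!scalerA.
- move=> a x a1 bx c c1; rewrite scalerA; apply: bx.
  by rewrite normrM mulr_ile1.
- move=> K cK.
  have nbK : nbhs (radonMc_incl cK (0 : radonM_in R K)) b by rewrite radonMc_incl0.
  have := iK K cK 0; move=> /(_ _ nbK)/(@nbhs_normP _ (radonM_in R K))[e e0 eb].
  exists e => // z ze a a1; rewrite -radonMc_inclZ; apply: eb => /=.
  by rewrite sub0r normrN normrZ (le_lt_trans _ ze)// ler_piMl.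
Qed.

End VectorTopology.

Lemma biadditive_subrK (V W : zmodType) (f : V -> V -> W) :
  (forall x y z, f (x + y) z = f x z + f y z) ->
  (forall x y z, f x (y + z) = f x y + f x z) ->
  forall x0 y0 x y,
  f x y = f (x - x0) (y - y0) + f (x - x0) y0 + f x0 (y - y0) + f x0 y0.
Proof.
move=> fDl fDr x0 y0 x y; rewrite -[in LHS](subrK x0 x) -[in LHS](subrK y0 y).
by rewrite fDl !fDr addrA.
Qed.

Section BilinearContinuity.
Context (R : realType) (G : hausdorffTopGroupType).
Local Notation Mc := (radonMc R G).
Implicit Types x y z : Mc.

Lemma convolutionDl x y z : convolution (x + y) z = convolution x z + convolution y z.
Proof. by rewrite -[x]scale1r convolution_linl !scale1r. Qed.

Lemma convolutionDr x y z : convolution x (y + z) = convolution x y + convolution x z.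
Proof. by rewrite -[y]scale1r convolution_linr !scale1r. Qed.

Lemma convolution0l z : convolution 0 z = 0.
Proof. by apply: (addrI (convolution 0 z)); rewrite -convolutionDl !addr0. Qed.

Lemma convolution0r z : convolution z 0 = 0.
Proof. by apply: (addrI (convolution z 0)); rewrite -convolutionDr !addr0. Qed.

Lemma convolutionZl (a : R[i]) x z : convolution (a *: x) z = a *: convolution x z.
Proof. by rewrite -[a *: x]addr0 convolution_linl convolution0l addr0. Qed.

Lemma convolutionZr (a : R[i]) x z : convolution x (a *: z) = a *: convolution x z.
Proof. by rewrite -[a *: z]addr0 convolution_linr convolution0r addr0. Qed.

(** Near [(x0, y0)] the increment splits into the values at [(x - x0, y - y0)],
[(x - x0, y0)] and [(x0, y - y0)]. The hypothesis covers the first; the other two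
reduce to it by moving a small scalar from one factor to the other. *)
Lemma convolution_continuous :
  (forall U : set Mc, nbhs 0 U -> exists2 V : set Mc, nbhs 0 V &
    forall x y, V x -> V y -> U (convolution x y)) ->
  continuous (fun p : Mc * Mc => convolution p.1 p.2).
Proof.
move=> h0 [x0 y0] A /= nA.
rewrite -[convolution x0 y0]add0r in nA.
have nU := radonMc_translate_nbhs nA.
rewrite -[in nbhs 0 _](addr0 0) in nU.
have [U1 nU1 [U2 nU2 U12]] := radonMc_add_nbhs nU.
rewrite -[in nbhs 0 U1](addr0 0) in nU1.
have [U3 nU3 [U4 nU4 U34]] := radonMc_add_nbhs nU1.
have [V nV VU] := h0 _ (filterI (filterI nU3 nU4) nU2).
have [r r0 Vr] := radonMc_absorbing y0 nV; have [s s0 Vs] := radonMc_absorbing x0 nV.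
have half (e : R) : 0 < e -> 0 < e / 2 /\ e / 2 < e.
  by move=> e0; rewrite divr_gt0// gtr_pMr// invf_lt1// ltr1n.
have [r20 r2] := half r r0; have [s20 s2] := half s s0.
pose a := (r / 2)%:C%C : R[i]; pose b := (s / 2)%:C%C : R[i].
have a0 : a != 0 by rewrite gt_eqF// /a (ltcR 0).
have b0 : b != 0 by rewrite gt_eqF// /b (ltcR 0).
have shift (w : Mc) W : nbhs 0 W -> nbhs w [set v : Mc | W (v - w)].
  by move=> nW; apply: radonMc_translate_nbhs; rewrite subrr.
exists ([set x : Mc | V (x - x0) /\ V (a^-1 *: (x - x0))],
        [set y : Mc | V (y - y0) /\ V (b^-1 *: (y - y0))]).
  split=> /=.
    apply: (shift x0 [set v | V v /\ V (a^-1 *: v)]).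
    by apply: filterI => //; exact: radonMc_scale_nbhs0.
  apply: (shift y0 [set v | V v /\ V (b^-1 *: v)]).
  by apply: filterI => //; exact: radonMc_scale_nbhs0.
move=> [x y] [/= [Vx Vax] [Vy Vby]].
have -> : convolution x y = convolution (x - x0) (y - y0) +
    convolution (a^-1 *: (x - x0)) (a *: y0) + convolution (b *: x0) (b^-1 *: (y - y0)) +
    convolution x0 y0.
  have -> : convolution (a^-1 *: (x - x0)) (a *: y0) = convolution (x - x0) y0.
    by rewrite convolutionZl convolutionZr scalerA mulVf// scale1r.
  have -> : convolution (b *: x0) (b^-1 *: (y - y0)) = convolution x0 (y - y0).
    by rewrite convolutionZl convolutionZr scalerA divff// scale1r.
  exact: (biadditive_subrK convolutionDl convolutionDr).
apply: U12; last by have [_ ] := VU _ _ (Vs _ s20 s2) Vby.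
by apply: U34; [have [[]] := VU _ _ Vx Vy|have [[]] := VU _ _ Vax (Vr _ r20 r2)].
Qed.

End BilinearContinuity.

(** * Hemicompact groups *)

Section Hemicompact.
Context (R : realType) (G : hausdorffTopGroupType).
Local Notation Mc := (radonMc R G).

Definition absolutely_convex_hull (B : set Mc) : set Mc := fun x =>
  forall D : set Mc, convex_subset D -> balanced_subset D -> B `<=` D -> D x.

Lemma convex_hull (B : set Mc) : convex_subset (absolutely_convex_hull B).
Proof.
move=> t x y t0 t1 Hx Hy D cD bD BD.
exact: (cD _ _ _ t0 t1 (Hx D cD bD BD) (Hy D cD bD BD)).
Qed.

Lemma balanced_hull (B : set Mc) : balanced_subset (absolutely_convex_hull B).
Proof. by move=> a x a1 Hx D cD bD BD; exact: (bD _ _ a1 (Hx D cD bD BD)). Qed.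

Lemma sub_hull (B : set Mc) : B `<=` absolutely_convex_hull B.
Proof. by move=> x Bx D _ _; apply. Qed.

(** The points that [f _ y] maps into [U] form an absolutely convex set, so if it
contains [B] it contains the hull; then the same with the factors exchanged. *)
Lemma bilinear_hull (f : Mc -> Mc -> Mc) (B U : set Mc) :
  (forall x y z, f (x + y) z = f x z + f y z) ->
  (forall x y z, f x (y + z) = f x y + f x z) ->
  (forall (a : R[i]) x z, f (a *: x) z = a *: f x z) ->
  (forall (a : R[i]) x z, f x (a *: z) = a *: f x z) ->
  convex_subset U -> balanced_subset U -> (forall x y, B x -> B y -> U (f x y)) ->
  forall x y, absolutely_convex_hull B x -> absolutely_convex_hull B y -> U (f x y).
Proof.
move=> fDl fDr fZl fZr cU bU BU x y Hx Hy; apply: (Hy [set y | U (f x y)]) => /=.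
- by move=> t u v t0 t1 Uu Uv /=; rewrite fDr !fZr; exact: cU.
- by move=> a u a1 Uu /=; rewrite fZr; exact: bU.
move=> {Hy}y By /=; apply: (Hx [set x | U (f x y)]) => /=.
- by move=> t u v t0 t1 Uu Uv /=; rewrite fDl !fZl; exact: cU.
- by move=> a u a1 Uu /=; rewrite fZl; exact: bU.
- by move=> u Bu; exact: BU.
Qed.

Lemma radonM_in_normE (K : set G) (z : radonM_in R K) :
  `|z| = (radonM_norm z)%:C%C.
Proof. by []. Qed.

Lemma radonMc_incl_of (K : set G) (cK : compact K) (x : Mc) : supp x `<=` K ->
  exists2 z : radonM_in R K, x = radonMc_incl cK z & `|z| = (radonM_norm x)%:C%C.
Proof.
move=> sK; have sxK : (x : radonM R G) \in @supported_in R G K by exact/asboolP.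
by exists (RadonMIn sxK) => //; apply: val_inj.
Qed.

Lemma radonM_norm_ge0 (x : radonM R G) : 0 <= radonM_norm x.
Proof. by apply: fine_ge0; rewrite tv_ge0. Qed.

(** Let [U] contain the [e n]-ball of M_L for [L = K n * K n]. With radii [r n <= 1]
and [r n <= e n / 32], measures in the [r m]-ball over [K m] and the [r n]-ball over
[K n] convolve into the [e M]-ball for [M] the larger index: one radius is at most
[r M], the other at most 1. The hull of all these balls is a neighbourhood of 0 since
every compact set lies in some [K n]. *)
Lemma convolution_continuous_hemicompact : hemicompact G ->
  continuous (fun p : Mc * Mc => convolution p.1 p.2).
Proof.
move=> [K [cK Kmono _ Kfin]]; apply: convolution_continuous => U0.
move=> /radonMc_convex_nbhs[U UU0 [cU bU aU]].
have KS m n : (m <= n)%N -> K m `<=` K n.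
  elim: n => [|n ih]; first by rewrite leqn0 => /eqP->.
  rewrite leq_eqVlt => /predU1P[-> //|]; rewrite ltnS => /ih h.
  exact: subset_trans h (Kmono n).
have cKK n := compact_mul_set (cK n) (cK n).
have /choice[e eP] : forall n, exists e : R, 0 < e /\
    forall z : radonM_in R (mul_set (K n) (K n)), `|z| < e%:C%C -> U (radonMc_incl (cKK n) z).
  move=> n; have [[e e'] e0 h] := aU _ (cKK n).
  by move: e0 h; rewrite ltcE/= => /andP[/eqP-> e0] h; exists e.
pose r n := Num.min 1 (e n / 32).
have r0 n : 0 < r n by rewrite lt_min ltr01 divr_gt0//; have [] := eP n.
have r1 n : r n <= 1 by rewrite ge_min lexx.
have re n : r n <= e n / 32 by rewrite ge_min lexx orbT.
pose B : set Mc := [set x : Mc | exists2 n, supp x `<=` K n & radonM_norm x <= r n].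
exists (absolutely_convex_hull B).
  apply: disk_nbhs0; [exact: convex_hull|exact: balanced_hull|].
  move=> L cL; have [n Ln] := Kfin L cL.
  exists (r n)%:C%C; first by rewrite (ltcR 0).
  move=> z; rewrite radonM_in_normE => zr; apply: sub_hull; exists n.
    have /asboolP sz := radonM_in_subproof z.
    exact: subset_trans sz Ln.
  by move: zr; rewrite ltcR => /ltW.
move=> x y Hx Hy; apply: UU0.
apply: (bilinear_hull (@convolutionDl R G) (@convolutionDr R G)
  (@convolutionZl R G) (@convolutionZr R G) cU bU _ Hx Hy).
move=> {Hx Hy}x {}y [m sx nx] [n sy ny].
pose M := maxn m n.
have sxM : supp x `<=` K M by apply: subset_trans sx _; apply: KS; exact: leq_maxl.
have syM : supp y `<=` K M by apply: subset_trans sy _; apply: KS; exact: leq_maxr.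
have [z zxy zE] := radonMc_incl_of (cKK M) (supp_convolution (cK M) (cK M) sxM syM).
rewrite zxy; apply: (eP M).2; rewrite zE ltcR.
apply: le_lt_trans (convolution_norm x y) _.
have nxy : radonM_norm x * radonM_norm y <= r M.
  rewrite /M; case: (leqP m n) => _.
    rewrite -[leRHS]mul1r; apply: ler_pM; rewrite ?radonM_norm_ge0//.
    exact: le_trans nx (r1 m).
  rewrite -[leRHS]mulr1; apply: ler_pM; rewrite ?radonM_norm_ge0//.
  exact: le_trans ny (r1 n).
have := re M; have := r0 M; have := (eP M).1; lra.
Qed.

End Hemicompact.

(** * An undominated function on a product of uncountable sets *)

Section UncountableProduct.
Local Open Scope nat_scope.

Lemma countable_fibres (T : Type) (A : set T) (f : T -> nat) :
  (forall k, countable (A `&` [set x | f x = k])) -> countable A.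
Proof.
move=> cf; apply: (@sub_countable _ _ _ (\bigcup_k (A `&` [set x | f x = k]))).
  by apply: subset_card_le => x Ax; exists (f x).
exact: bigcup_countable.
Qed.

(** A maximal partial bijection between [A] and [B] exhausts one of them, hence is
uncountable. It serves as a common index set for parts of [A] and [B]. *)
Lemma uncountable_matching (T U : Type) (A : set T) (B : set U) :
  ~ countable A -> ~ countable B ->
  exists M : set (T * U), [/\ ~ countable M, M `<=` A `*` B &
    forall p q, M p -> M q -> (p.1 = q.1 -> p = q) /\ (p.2 = q.2 -> p = q)].
Proof.
move=> uA uB.
pose P := [set M : set (T * U) | M `<=` A `*` B /\
  forall p q, M p -> M q -> (p.1 = q.1 -> p = q) /\ (p.2 = q.2 -> p = q)].
have [F FP Ftot|M [[MAB Minj] Mmax]] := @Zorn_bigcup _ P.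
  split=> [p [M FM Mp]|p q [M FM Mp] [N FN Nq]]; first exact: (FP M FM).1.
  have [MN|NM] := Ftot M N FM FN; first by apply: (FP N FN).2 => //; exact: MN.
  by apply: (FP M FM).2 => //; exact: NM.
exists M; split=> // cM.
have cimg (V : Type) (f : T * U -> V) : countable (f @` M).
  exact: sub_countable (card_image_le _ _) cM.
have [a [Aa na]] : exists a, A a /\ ~ (fst @` M) a.
  apply: contrapT => h; apply: uA; apply: sub_countable (cimg _ fst).
  apply: subset_card_le => a Aa; apply: contrapT => na; apply: h; by exists a.
have [b [Bb nb]] : exists b, B b /\ ~ (snd @` M) b.
  apply: contrapT => h; apply: uB; apply: sub_countable (cimg _ snd).
  apply: subset_card_le => b Bb; apply: contrapT => nb; apply: h; by exists b.
apply: (Mmax (M `|` [set (a, b)])).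
  split=> [p|]; first by left.
  move=> /(_ (a, b) (or_intror erefl)) Mab; apply: na; by exists (a, b).
split=> [p [/MAB //|->]//|p q [Mp|->] [Mq|->]] /=.
- exact: Minj.
- by split=> e; [case: na; rewrite -e; exists p|case: nb; rewrite -e; exists p].
- by split=> e; [case: na; rewrite e; exists q|case: nb; rewrite e; exists q].
- by [].
Qed.

(** Well-order the type and stop at the first element of [A] with uncountably many
predecessors in [A], if there is one. *)
Lemma uncountable_order (T : eqType) (A : set T) : ~ countable A ->
  exists (B : set T) (r : rel T), [/\ ~ countable B, B `<=` A, total r &
    forall q, B q -> countable (B `&` [set p | r p q])].
Proof.
move=> uA; have [r wo] := wochoice.well_ordering_principle T.
have two x y : exists! z, wochoice.minimum_of r (pred2 x y) z.
  by apply: wo; exists x; rewrite inE eqxx.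
have rtot : total r.
  move=> x y; have [z [[zxy zmin] _]] := two x y.
  have := zmin x; have := zmin y; rewrite !inE !eqxx orbT /= => /(_ isT) + /(_ isT).
  by move: zxy; rewrite inE => /orP[] /eqP ->; [move=> -> _|move=> _ ->; rewrite orbT].
have rrefl x : r x x by have /orP[] := rtot x x.
have ranti x y : r x y -> r y x -> x = y.
  move=> xy yx; have [z [_ zu]] := two x y.
  transitivity z; [symmetry|]; apply: zu; split; rewrite ?inE ?eqxx ?orbT //.
  - by move=> t; rewrite inE => /orP[] /eqP ->.
  - by move=> t; rewrite inE => /orP[] /eqP ->.
pose Q := [pred q | `[< A q /\ ~ countable (A `&` [set p | r p q]) >]].
have [[q Qq]|nQ] := pselect (exists q, Q q); last first.
  exists A, r; split=> // q Aq; apply: contrapT => uq; apply: nQ.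
  by exists q; apply/asboolP.
have [q0 [[/asboolP[Aq0 uq0] minq0] _]] := wo Q (ex_intro _ q Qq).
exists (A `&` [set p | r p q0 /\ p <> q0]), r; split=> //.
- move=> cB; apply: uq0.
  apply: (@sub_countable _ _ _ ((A `&` [set p | r p q0 /\ p <> q0]) `|` [set q0])).
    apply: subset_card_le => p [Ap rp]; have [->|pq] := pselect (p = q0); first by right.
    by left.
  rewrite -bigcup2E; apply: bigcup_countable => // -[|[|i]] _ //=.
- move=> p [Ap [rp np]]; apply: contrapT => up.
  have Qp : Q p.
    apply/asboolP; split=> // cp; apply: up; apply: sub_countable cp.
    by apply: subset_card_le => t [[At _] rt].
  by apply: np; apply: ranti rp _; exact: minq0.
Qed.

Lemma injective_unbounded (f : nat -> nat) (k : nat) : injective f -> exists i, k < f i.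
Proof.
move=> fi; apply: contrapT => h.
have fk (i : 'I_k.+2) : f i < k.+1.
  by rewrite ltnS leqNgt; apply/negP => lt; apply: h; exists i.
have : injective (fun i => Ordinal (fk i)) by move=> i j [/fi/val_inj].
by move=> /leq_card; rewrite !card_ord ltnn.
Qed.

(** Index parts of [A] and [B] by one set ordered with countable initial segments, and
let [F a b] number the predecessors of the index of [b] injectively. Given [n] and
[m], pass to uncountably many indices on which they are constant, say [k] and [l].
Infinitely many indices of the first kind lie below a single index of the second
kind, so their numbers are not bounded by [k * l]. *)
Lemma undominated_product (T U : eqType) (A : set T) (B : set U) :
  ~ countable A -> ~ countable B ->
  exists F : T -> U -> nat, forall (n : T -> nat) (m : U -> nat),
    exists a b, [/\ A a, B b & n a * m b < F a b].
Proof.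
move=> uA uB; have [M [uM MAB Minj]] := uncountable_matching uA uB.
have [G [r [uG GM rtot seg]]] := uncountable_order uM.
have Ginj p q : G p -> G q -> (p.1 = q.1 -> p = q) /\ (p.2 = q.2 -> p = q).
  by move=> /GM Mp /GM Mq; exact: Minj.
have /choice[e eP] : forall q, exists e : T * U -> nat,
    G q -> {in G `&` [set p | r p q] &, injective e}.
  move=> q; have [Gq|nG] := pselect (G q); last by exists (fun=> 0).
  by have /countable_injP[e ei] := seg q Gq; exists e.
have /choice[F FP] : forall ab : T * U, exists k, forall p q,
    G p -> G q -> p.1 = ab.1 -> q.2 = ab.2 -> k = e q p.
  move=> [a b]; have [[p [q [Gp Gq <- <-]]]|h] := pselect (exists p q,
      [/\ G p, G q, p.1 = a & q.2 = b]).
    exists (e q p) => p' q' Gp' Gq' /= pp qq.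
    by rewrite ((Ginj _ _ Gp' Gp).1 pp) ((Ginj _ _ Gq' Gq).2 qq).
  by exists 0 => p q Gp Gq /= pa qb; case: h; exists p, q.
exists (fun a b => F (a, b)) => n m.
have fibre (f : T * U -> nat) : exists k, ~ countable (G `&` [set p | f p = k]).
  apply: contrapT => h; apply: uG; apply: (@countable_fibres _ _ f) => k.
  by apply: contrapT => uk; apply: h; exists k.
have [k uk] := fibre (fun p => n p.1); have [l ul] := fibre (fun p => m p.2).
have [s sinj sG] : exists2 s : nat -> T * U, injective s &
    forall i, G (s i) /\ n (s i).1 = k.
  have : infinite_set (G `&` [set p | n p.1 = k]) by move=> /finite_set_countable.
  move=> /infiniteP/card_leP[s].
  have iT (i : nat) : i \in [set: nat] by rewrite inE.
  exists (fun i => val (s (exist _ i (iT i)))).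
    move=> i j /val_inj/(@inj _ _ _ s) h.
    by have [] := h (mem_set I) (mem_set I).
  by move=> i; have := valP (s (exist _ i (iT i))); rewrite inE.
have [q [Gq mq rq]] : exists q, [/\ G q, m q.2 = l & forall i, r (s i) q].
  apply: contrapT => h; apply: ul.
  apply: (@sub_countable _ _ _ (\bigcup_i (G `&` [set q | r q (s i)]))); last first.
    by apply: bigcup_countable => // i _; apply: seg; exact: (sG i).1.
  apply: subset_card_le => q [Gq mq]; apply: contrapT => nq; apply: h; exists q.
  split=> // i; have /orP[//|rqs] := rtot (s i) q.
  by case: nq; exists i.
have [i ki] : exists i, k * l < e q (s i).
  apply: (@injective_unbounded (e q \o s)) => i j /= eij; apply: sinj.
  apply: (eP q Gq) eij; rewrite inE; split; [exact: (sG i).1|exact: rq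
    |exact: (sG j).1|exact: rq].
exists (s i).1, q.2; split.
- by have [] := MAB _ (GM _ (sG i).1).
- by have [] := MAB _ (GM _ Gq).
- by rewrite (FP (_, _) (s i) q)//; [rewrite (sG i).2 mq|exact: (sG i).1].
Qed.

End UncountableProduct.

(** * Spacious groups *)

Section Dirac.
Context (R : realType) (X : hausdorffType).

Definition complex_dirac (a : X) : set (borel X) -> R[i]^o :=
  complex_of_measure (dirac (a : borel X)).

Lemma complex_diracE (a : X) (A : set (borel X)) : measurable A ->
  complex_dirac a A = ((a \in A)%:R)%:C%C.
Proof. by move=> mA; rewrite /complex_dirac /complex_of_measure asboolT// diracE. Qed.

Lemma dirac_finite (a : X) : (dirac (a : borel X) setT < +oo :> \bar R)%E.
Proof. by rewrite diracE ltry. Qed.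

Lemma radon_dirac (a : X) : radon (dirac (a : borel X) : {measure set (borel X) -> \bar R}).
Proof.
apply: tight_radon; first exact: dirac_finite.
move=> A e mA e0; have [Aa|nAa] := pselect (A a).
  exists [set a]; split; [exact: compact_set1|by move=> _ ->|].
  by rewrite /= diracE memNset ?lee_fin ?ltW// => -[_ /(_ erefl)].
exists set0; split; [exact: compact0|by []|].
by rewrite setD0 /= diracE memNset ?lee_fin ?ltW.
Qed.

Lemma complex_radon_dirac (a : X) : complex_radon (complex_dirac a).
Proof. by apply: complex_radon_of_measure; [exact: dirac_finite|exact: radon_dirac]. Qed.

Lemma supp_dirac (a : X) : supp (complex_dirac a) `<=` [set a].
Proof.
have ca : closed [set a] by apply: compact_closed; [exact: hausdorff|exact: compact_set1].
have mC := measurableC (closed_borel ca).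
apply: bigcap_inf; split=> //; apply/eqP; rewrite eq_le tv_ge0// andbT.
apply: le_trans (tv_complex_of_measure (dirac_finite a) mC) _.
by rewrite /= diracE memNset// => /(_ erefl).
Qed.

Fact radonM_dirac_subproof (a : X) : complex_dirac a \in @complex_radon_pred R X.
Proof. by apply/asboolP; exact: complex_radon_dirac. Qed.

Fact radonMc_dirac_subproof (a : X) :
  RadonM (radonM_dirac_subproof a) \in @compactly_supported R X.
Proof.
apply/asboolP; exists [set a]; first exact: compact_set1.
by apply/asboolP; exact: supp_dirac.
Qed.

Definition radonMc_dirac (a : X) : radonMc R X := RadonMc (radonMc_dirac_subproof a).

End Dirac.

Section SpaciousGroup.
Context (R : realType) (G : hausdorffTopGroupType).
Local Notation Mc := (radonMc R G).
Local Notation C := R[i].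

Lemma complex_product_dirac (a b : G) :
  complex_product (complex_dirac R a) (complex_dirac R b) =
  complex_dirac R ((a, b) : G * G) :> (set (borel (G * G)%type) -> R[i]^o).
Proof.
apply/esym/complex_product_unique; [exact: complex_radon_dirac..|].
move=> A B mA mB; rewrite !complex_diracE//; last exact: borel_setX.
by rewrite in_setX/= -rmorphM/= -natrM mulnb.
Qed.

Lemma borel_set1 (x : G) : measurable ([set x] : set (borel G)).
Proof. by apply: compact_borel; exact: compact_set1. Qed.

Lemma convolution_dirac (a b : G) :
  convolution (radonMc_dirac R a) (radonMc_dirac R b) [set (a * b)%g] = 1.
Proof.
rewrite convolutionE convolution_fun_pushforward /complex_pushforward.
rewrite asboolT; last exact: borel_set1.
rewrite complex_product_dirac complex_diracE ?mem_set//.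
by apply: continuous_borel; [exact: mulg_continuous|exact: borel_set1].
Qed.

Lemma radonM_mod_set1 (mu : radonM R G) (x : G) :
  `|mu [set x]| <= (radonM_norm mu)%:C%C.
Proof.
rewrite modE lecR -lee_fin /radonM_norm fineK; last by apply: tv_fin => //; exact: radonMP.
apply: le_trans (mod_le_tv mu (borel_set1 x)) _.
by apply: tv_mono => //; [exact: radonMP|exact: borel_set1].
Qed.

Lemma radonM_set1_off_supp (mu : radonM R G) (x : G) : ~ supp mu x -> mu [set x] = 0.
Proof.
move=> nx; apply: tv_le0; first exact: borel_set1.
rewrite -(tv_supp (radonMP mu)); apply: tv_mono; [exact: radonMP|exact: borel_set1| |].
  by apply: measurableC; apply: closed_borel; exact: closed_supp.
by move=> _ ->.
Qed.

(** Each point [x] of the group carries the constraints of all pairs with product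
[x]; there are finitely many by spaciousness, so the constraints can be met. *)
Definition atoms_le (A B : set G) (F : G -> G -> nat) : set Mc := fun mu =>
  forall a b, A a -> B b -> `|mu [set (a * b)%g]| * (F a b)%:R <= 1.

(** On M_K only the finitely many pairs with product in [K] matter, and the atoms are
bounded by the norm. *)
Lemma nbhs_atoms_le (A B : set G) (F : G -> G -> nat) :
  (forall K : set G, compact K ->
    finite_set [set p : G * G | [/\ A p.1, B p.2 & K (p.1 * p.2)%g]]) ->
  nbhs 0 (atoms_le A B F).
Proof.
move=> fin; apply: disk_nbhs0.
- move=> t x y t0 t1 xU yU a b Aa Bb.
  have -> : (t *: x + (1 - t) *: y : Mc) [set (a * b)%g] =
    t * x [set (a * b)%g] + (1 - t) * y [set (a * b)%g] by [].
  have s0 : 0 <= 1 - t by rewrite subr_ge0.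
  apply: (@le_trans _ _ (t * (`|x [set (a * b)%g]| * (F a b)%:R) +
                         (1 - t) * (`|y [set (a * b)%g]| * (F a b)%:R))).
    rewrite !mulrA -mulrDl ler_wpM2r//; apply: le_trans (ler_normD _ _) _.
    by rewrite !normrM (ger0_norm t0) (ger0_norm s0).
  apply: (@le_trans _ _ (t * 1 + (1 - t) * 1)); last by rewrite !mulr1 addrC subrK.
  by apply: lerD; apply: ler_wpM2l => //; [exact: xU|exact: yU].
- move=> c x c1 xU a b Aa Bb.
  have -> : (c *: x : Mc) [set (a * b)%g] = c * x [set (a * b)%g] by [].
  apply: le_trans (xU a b Aa Bb); rewrite ler_wpM2r// normrM ler_piMl//.
- move=> K cK; have /finite_seqP[s sE] := fin K cK.
  pose N := \max_(p <- s) F p.1 p.2.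
  exists (N.+1%:R^-1); first by rewrite invr_gt0 ltr0n.
  move=> z zN a b Aa Bb.
  have [Kab|nKab] := pselect (K (a * b)%g); last first.
    rewrite radonM_set1_off_supp ?normr0 ?mul0r// => sab; apply: nKab.
    by have /asboolP := radonM_in_subproof z; apply.
  have FN : (F a b <= N)%N.
    have : (a, b) \in s.
      by have : [set p : G * G | [/\ A p.1, B p.2 & K (p.1 * p.2)%g]] (a, b) by []; rewrite sE.
    by move=> abs; apply: (@leq_bigmax_seq _ s xpredT (fun p => F p.1 p.2) (a, b)).
  apply: (@le_trans _ _ (N.+1%:R^-1 * N.+1%:R)); last by rewrite mulVf// pnatr_eq0.
  apply: ler_pM => //; last by rewrite ler_nat ltnW.
  exact: le_trans (radonM_mod_set1 _ _) (ltW zN).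
Qed.

(** A neighbourhood of 0 contains some multiple [(n x).+1%:R^-1] of each point mass. If
products of such multiples obeyed the bounds [atoms_le], the functions [n] and [m]
would dominate [F]. *)
Lemma convolution_not_continuous_spacious : spacious G ->
  ~ continuous (fun p : Mc * Mc => convolution p.1 p.2).
Proof.
move=> [A [B [uA uB fin]]] cont.
have [F Fdom] := undominated_product uA uB.
have nU : nbhs (convolution (0 : Mc) 0) (atoms_le A B F).
  by rewrite convolution0l; exact: nbhs_atoms_le.
have [[V W] [/= nV nW] VW] := cont (0, 0) _ nU.
have scale (V' : set Mc) : nbhs 0 V' ->
    exists n : G -> nat, forall x, V' ((n x).+1%:R^-1 *: radonMc_dirac R x).
  move=> nV'; suff /choice[n nP] : forall x : G, exists n : nat,
    V' (n.+1%:R^-1 *: radonMc_dirac R x) by exists n.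
  move=> x.
  have [e e0 h] := radonMc_absorbing (radonMc_dirac R x) nV'.
  exists (Num.truncn e^-1).
  rewrite -[_^-1](_ : ((Num.truncn e^-1).+1%:R^-1)%:C%C = _); last first.
    by rewrite fmorphV/= rmorph_nat.
  apply: h; first by rewrite invr_gt0 ltr0n.
  by rewrite invf_plt ?posrE ?ltr0n//; exact: truncnS_gt.
have [n nP] := scale V nV; have [m mP] := scale W nW.
have [a [b [Aa Bb]]] := Fdom (fun x => (n x).+1) (fun x => (m x).+1).
have := VW (_, _) (conj (nP a) (mP b)) a b Aa Bb => /=.
rewrite convolutionZl convolutionZr scalerA.
set mu := convolution _ _.
have -> : ((n a).+1%:R^-1 / (m b).+1%:R *: mu : Mc) [set (a * b)%g] =
  (n a).+1%:R^-1 / (m b).+1%:R * mu [set (a * b)%g] by [].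
rewrite convolution_dirac mulr1 -invfM -natrM.
rewrite ger0_norm ?invr_ge0// ler_pdivrMl ?ltr0n// mulr1 ler_nat.
by rewrite leqNgt => /negbTE ->.
Qed.

End SpaciousGroup.

Theorem theoremB (R : realType) (G : hausdorffTopGroupType) :
  (hemicompact G ->
     continuous (fun p : radonMc R G * radonMc R G => convolution p.1 p.2)) /\
  (spacious G ->
     ~ continuous (fun p : radonMc R G * radonMc R G => convolution p.1 p.2)).
Proof.
split; first exact: convolution_continuous_hemicompact.
exact: convolution_not_continuous_spacious.
Qed.
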